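(* Suppose that $m$ is a non-rational Herglotz--Nevanlinna function with measure $\rho$ in its integral representation. Then all moments of the measure $\rho$ exist if and only if there are Herglotz--Nevanlinna functions $\tilde m_1,\tilde m_2,\ldots$, non-negative constants $\upsilon_0,\upsilon_1,\ldots$, real constants $\omega_0,\omega_1,\ldots$ and positive constants $l_1,l_2,\ldots$ with $\upsilon_n+|\omega_n|>0$ for all $n\in\mathbb{N}$ such that for every $N\in\mathbb{N}$ the function $m$ admits the continued fraction expansion $$m(z) = \upsilon_0 z + \omega_0 + \cfrac{1}{-l_{1}z + \cfrac{1}{\upsilon_1 z + \omega_1 + \cfrac{1}{ \;\ddots\; + \cfrac{1}{-l_{N} z + \cfrac{1}{\tilde{m}_N(z)}}}}}\,, \quad z\in\mathbb{C}\backslash\mathbb{R}.$$ In this case, with the Hankel determinants $\Delta_{j,k}$ and the function $\kappa:\mathbb{N}\to\mathbb{N}_0$ as described in the context, the constants are given by $$\upsilon_0 = -\frac{\Delta_{-2,1}}{\Delta_{0,0}},\qquad \upsilon_n = \frac{\Delta_{-2,\kappa(n)+2}}{\Delta_{0,\kappa(n)+1}} - \frac{\Delta_{-2,\kappa(n+1)+1}}{\Delta_{0,\kappa(n+1)}},$$ $$\omega_0 = -\frac{\Delta_{-1,1}}{\Delta_{1,0}},\qquad \omega_n = \frac{\Delta_{-1,\kappa(n)+1}}{\Delta_{1,\kappa(n)}} - \frac{\Delta_{-1,\kappa(n+1)+1}}{\Delta_{1,\kappa(n+1)}},$$ $$l_n = \frac{\Delta_{1,\kappa(n)}^2}{\Delta_{0,\kappa(n)}\Delta_{0,\kappa(n)+1}}$$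 for all $n\in\mathbb{N}$.
   Context: A Herglotz--Nevanlinna function is an analytic function $m$ on $\mathbb{C}\backslash\mathbb{R}$ which maps the upper half-plane into the closure of the upper half-plane and satisfies $m(z)^\ast=m(z^\ast)$. It has a unique integral representation $$m(z)= a + bz + \int_{\mathbb{R}} \Big(\frac{1}{\lambda-z} - \frac{\lambda}{1+\lambda^2}\Big)d\rho(\lambda),\quad z\in\mathbb{C}\backslash\mathbb{R},$$ with $a\in\mathbb{R}$, $b\geq0$ and a non-negative Borel measure $\rho$ on $\mathbb{R}$ with $\int_{\mathbb{R}}(1+\lambda^2)^{-1}d\rho(\lambda)<\infty$. All moments of $\rho$ exist if $\int_{\mathbb{R}}|\lambda|^k\,d\rho(\lambda)<\infty$ for all $k\in\mathbb{N}_0$. In that case define $s_k=\int_{\mathbb{R}}\lambda^k\,d\rho(\lambda)$ for $k\in\mathbb{N}_0$ and $s_{-2}=-b$, $s_{-1}=\int_{\mathbb{R}}\frac{\lambda}{1+\lambda^2}d\rho(\lambda)-a$. For $j\in\{-2,-1,0,1,2\}$ and $k\in\mathbb{N}_0$ let $\Delta_{j,k}=\det(s_{j+p+q})_{p,q=0}^{k-1}$ be the $k\times k$ Hankel determinant with top-left entry $s_j$ and bottom-right entry $s_{j+2k-2}$; all are equal to one when $k=0$. For non-rational $m$, the sequence $\Delta_{1,0},\Delta_{1,1},\dots$ has no two consecutive zeros, and $\kappa:\mathbb{N}\to\mathbb{N}_0$ is the increasing function such that $\Delta_{1,\kappa(1)},\Delta_{1,\kappa(2)},\ldots$ enumerates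 all its non-zero elements (so $\kappa(1)=0$). For $N=1$ the continued fraction reads $m(z)=\upsilon_0z+\omega_0+\dfrac{1}{-l_1z+\frac{1}{\tilde m_1(z)}}$. *)

(* Defs.v *)
From HB Require Import structures.
From mathcomp Require Import all_boot all_order all_algebra.
From mathcomp Require Import all_classical all_reals all_analysis.
From mathcomp Require Import complex.

Set Implicit Arguments.
Unset Strict Implicit.
Unset Printing Implicit Defensive.

Import Order.TTheory GRing.Theory Num.Theory numFieldNormedType.Exports.

Local Open Scope complex_scope.
Local Open Scope ring_scope.

Section HerglotzNevanlinna.
Context {R : realType}.

Definition nonreal (z : R[i]) : Prop := complex.Im z != 0.

(* Functions on the complement of the real line are encoded as total functions
   whose values on the real line are irrelevant. The type [R[i]^o] is the one
   carrying the normed [R[i]]-module structure of the complex plane, so that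
   [derivable _ z 1] is complex differentiability at [z]. *)
Definition herglotz (m : R[i] -> R[i]) : Prop :=
  [/\ forall z, nonreal z -> derivable (m : R[i]^o -> R[i]^o) z 1,
      forall z, 0 < complex.Im z -> 0 <= complex.Im (m z)
    & forall z, nonreal z -> (m z)^*%C = m (z^*%C)].

Definition rational_function (m : R[i] -> R[i]) : Prop :=
  exists p q : {poly R[i]},
    forall z, nonreal z -> q.[z] != 0 /\ m z = p.[z] / q.[z].

Definition cRintegral (rho : {measure set (measurableTypeR R) -> \bar R})
    (f : R -> R[i]) : R[i] :=
  (\int[rho]_x complex.Re (f x)) +i* (\int[rho]_x complex.Im (f x)).

Definition integral_representation (a b : R)
    (rho : {measure set (measurableTypeR R) -> \bar R})
    (m : R[i] -> R[i]) : Prop :=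
  [/\ 0 <= b,
      (\int[rho]_x ((1 + x ^+ 2)^-1)%:E < +oo)%E
    & forall z, nonreal z ->
        m z = a%:C + b%:C * z
          + cRintegral rho
              (fun x => (x%:C - z)^-1 - (x / (1 + x ^+ 2))%:C)].

Definition all_moments_exist
    (rho : {measure set (measurableTypeR R) -> \bar R}) : Prop :=
  forall k : nat, (\int[rho]_x (`|x| ^+ k)%:E < +oo)%E.

(* [Negz n] is the integer - (n + 1), so that the second and third cases are the
   indices -1 and -2; indices below -2 never occur. *)
Definition moment (a b : R)
    (rho : {measure set (measurableTypeR R) -> \bar R}) (j : int) : R :=
  match j with
  | Posz k => \int[rho]_x (x ^+ k)
  | Negz 0 => \int[rho]_x (x / (1 + x ^+ 2)) - a
  | Negz 1 => - b
  | Negz _ => 0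
  end.

Definition hankel_det (a b : R)
    (rho : {measure set (measurableTypeR R) -> \bar R})
    (j : int) (k : nat) : R :=
  \det (\matrix_(p < k, q < k) moment a b rho (j + p%:Z + q%:Z)).

(* [kappa] is indexed from 1; its value at 0 is irrelevant. *)
Definition enumerates_nonzero (d : nat -> R) (kappa : nat -> nat) : Prop :=
  (forall n n' : nat, (1 <= n)%N -> (n < n')%N -> (kappa n < kappa n')%N) /\
  (forall k : nat, d k != 0 <-> exists2 n : nat, (1 <= n)%N & kappa n = k).

(* [cfrac u w l n N t z] is the continued fraction
     u_n z + w_n + 1/(- l_(n+1) z + 1/(u_(n+1) z + w_(n+1) + ...
       + 1/(- l_(n+N) z + 1/t)...))
   with N blocks below the leading term. *)
Fixpoint cfrac (u w l : nat -> R) (n N : nat) (t z : R[i]) : R[i] :=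
  if N is N'.+1 then
    (u n)%:C * z + (w n)%:C
      + 1 / (- (l n.+1)%:C * z + 1 / cfrac u w l n.+1 N' t z)
  else t.

(* The parameters [mt] and [l] are indexed from 1. With the convention x / 0 = 0
   an identically vanishing [mt N] would make the last block - l_N z; this does
   not matter for non-rational [m], and for Herglotz-Nevanlinna functions [mt N]
   that do not vanish identically no denominator vanishes off the real line. *)
Definition cfrac_expansion (m : R[i] -> R[i]) (mt : nat -> R[i] -> R[i])
    (u w l : nat -> R) : Prop :=
  [/\ forall n, (1 <= n)%N -> herglotz (mt n),
      forall n, 0 <= u n,
      forall n, (1 <= n)%N -> 0 < l n,
      forall n, (1 <= n)%N -> 0 < u n + `|w n|
    & forall N z, (1 <= N)%N -> nonreal z -> m z = cfrac u w l 0 N (mt N z) z].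

End HerglotzNevanlinna.

(* Main.v *)
From HB Require Import structures.
Require Import Defs.
From mathcomp Require Import all_boot all_order all_algebra.
From mathcomp Require Import all_classical all_reals all_analysis.
From mathcomp Require Import measurable_realfun polyrcf complex.
From mathcomp Require Import ring lra zify.

Set Implicit Arguments.
Unset Strict Implicit.
Unset Printing Implicit Defensive.

Import Order.TTheory GRing.Theory Num.Theory numFieldNormedType.Exports.
Local Open Scope complex_scope.
Local Open Scope ring_scope.

(* Write [L p] for the integral of [p] and [S p z] for the integral of
   [p x / (x - z)] against [rho], so that [m z = b z - s_(-1) + S 1 z].  The
   denominators of the convergents of the continued fraction are characterized by
   orthogonality relations for [L]: those ending with [u_n z + w_n] are the
   orthogonal polynomials not vanishing at 0, normalized to be 1 there, and those
   ending with [- l_n z] are 'X times polynomials orthogonal for [x drho].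

   If all moments exist, polynomials with these relations can be built step by
   step, and the tails of the continued fraction are the quotients
   [- S C z / S A z] of the transforms of two consecutive denominators.  The
   imaginary part of [conj (S C z) * S A z] is [Im z] times the squared norm of
   [(S C z * A x - S A z * C x) / (x - z)] in [L^2(rho)], which is positive since
   [rho] has infinite support; this makes the tails Herglotz functions.

   Conversely, an expansion of arbitrary length makes [q m - p] decay along the
   imaginary axis for each convergent [p / q], at a rate governed by the degree of
   [q].  So [m] has asymptotic expansions of every order there, whence the
   moments by induction on their order.  Once the moments exist, the same decay
   shows [q m - p = S q] and turns into the orthogonality relations.  The
   formulas for the constants then follow from Cramer's rule. *)

(** * Orthogonality relations for the denominators *)

Section Orthogonality.
Variables (R : realFieldType) (L : {scalar {poly R}}).
Implicit Types (p q : {poly R}) (k : nat).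

Definition orth k p := forall i, (i < k)%N -> L (p * 'X^i) = 0.

Definition positive_definite := forall p, p != 0 -> 0 < L (p * p).

Lemma functional_expand p q n :
  (size q <= n)%N -> L (p * q) = \sum_(i < n) q`_i * L (p * 'X^i).
Proof.
move=> sq; rewrite -{1}(coefK q) poly_def mulr_sumr linear_sum /=.
rewrite (big_ord_widen n (fun i => L (p * (q`_i *: 'X^i)))) // big_mkcond /=.
apply: eq_bigr => i _; case: ltnP => [_|leqi]; first by rewrite -scalerAr linearZ.
by rewrite nth_default // mul0r.
Qed.

Lemma orthM k p q : orth k p -> (size q <= k)%N -> L (p * q) = 0.
Proof.
move=> op sq; rewrite (functional_expand p sq) big1 // => i _.
by rewrite op ?mulr0.
Qed.

Lemma orthM_lead k p q :
  orth k p -> (size q <= k.+1)%N -> L (p * q) = q`_k * L (p * 'X^k).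
Proof.
move=> op sq; rewrite (functional_expand p sq) big_ord_recr /= big1 ?add0r // => i _.
by rewrite op ?mulr0.
Qed.

Lemma orth_leq j k p : (j <= k)%N -> orth k p -> orth j p.
Proof. by move=> jk op i ij; apply: op; apply: leq_trans jk. Qed.

Lemma orth1 k p : (0 < k)%N -> orth k p -> L p = 0.
Proof. by move=> k0 /(_ 0%N k0); rewrite expr0 mulr1. Qed.

Lemma orth_eq0 k p :
  positive_definite -> orth k p -> (size p <= k)%N -> p = 0.
Proof.
move=> pd op sp; apply/eqP/negPn/negP => /pd.
by rewrite (orthM op sp) ltxx.
Qed.

End Orthogonality.

(* [C n] and ['X * Rr n] are the denominators of the convergents of the continued
   fraction that end with the terms [u_n z + w_n] and [- l_(n+1) z], and [k n] is
   the paper's [kappa (n + 1)]. *)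
Record chain (R : realFieldType) (L : {scalar {poly R}})
    (C Rr : nat -> {poly R}) (u w l : nat -> R) (k : nat -> nat) : Prop := {
  chain_C0 : C 0%N = 1;
  chain_R0 : Rr 0%N = (- l 1%N)%:P;
  chain_k0 : k 0%N = 0%N;
  chain_CS : forall n,
    C n.+1 = ((u n.+1)%:P * 'X + (w n.+1)%:P) * ('X * Rr n) + C n;
  chain_RS : forall n, Rr n.+1 = - l n.+2 *: C n.+1 + Rr n;
  chain_kS : forall n, k n.+1 = (k n + (u n.+1 != 0%R)).+1;
  chain_l : forall n, 0 < l n.+1;
  chain_uw : forall n, (u n.+1 != 0) || (w n.+1 != 0);
  chain_orthC : forall n, orth L (k n) (C n);
  chain_orthA : forall n, orth L (k n.+1).-1 ('X * Rr n);
  chain_LR : forall n, L (Rr n) = -1 }.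

Lemma size_affine (R : idomainType) (a b : R) :
  (a != 0) || (b != 0) -> size (a%:P * 'X + b%:P) = (a != 0).+1.
Proof.
rewrite size_MXaddC polyC_eq0 size_polyC.
by case: eqP => // _; case: eqP.
Qed.

(** * Degrees, orthogonality and norms along a chain *)

Section Chain.
Variables (R : realFieldType) (L : {scalar {poly R}}).
Variables (C Rr : nat -> {poly R}) (u w l : nat -> R) (k : nat -> nat).
Hypothesis ch : chain L C Rr u w l k.

Lemma chain_k_lt n : (k n < k n.+1)%N.
Proof. by rewrite (chain_kS ch) ltnS leq_addr. Qed.

Lemma chain_k_gt0 n : (0 < k n.+1)%N.
Proof. by rewrite (chain_kS ch). Qed.

Lemma chain_size n : size (C n) = (k n).+1 /\ size (Rr n) = (k n).+1.
Proof.
elim: n => [|n [sC sR]].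
  rewrite (chain_C0 ch) (chain_R0 ch) (chain_k0 ch) size_poly1 size_polyC oppr_eq0.
  by rewrite gt_eqF ?(chain_l ch).
have sA : size ('X * Rr n) = (k n).+2.
  by rewrite mulrC size_mulX ?sR // -size_poly_gt0 sR.
have A0 : 'X * Rr n != 0 by rewrite -size_poly_gt0 sA.
have su := size_affine (chain_uw ch n).
have sC' : size (C n.+1) = (k n.+1).+1.
  have sP : size (((u n.+1)%:P * 'X + (w n.+1)%:P) * ('X * Rr n)) = (k n.+1).+1.
    rewrite size_mul // -?size_poly_gt0 ?su // sA (chain_kS ch) addSn addnC.
    by rewrite addSn.
  by rewrite (chain_CS ch) size_polyDl // sP sC ltnS chain_k_lt.
split=> //; rewrite (chain_RS ch) size_polyDl size_scale ?oppr_eq0 ?gt_eqF ?(chain_l ch) //.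
by rewrite sC' sR ltnS chain_k_lt.
Qed.

Lemma chain_sizeC n : size (C n) = (k n).+1. Proof. by case: (chain_size n). Qed.
Lemma chain_sizeR n : size (Rr n) = (k n).+1. Proof. by case: (chain_size n). Qed.

Lemma chain_sizeA n : size ('X * Rr n) = (k n).+2.
Proof. by rewrite mulrC size_mulX ?chain_sizeR // -size_poly_gt0 chain_sizeR. Qed.

Lemma chain_C_at0 n : (C n)`_0 = 1.
Proof.
elim: n => [|n IH]; first by rewrite (chain_C0 ch) coef1.
by rewrite (chain_CS ch) coefD IH mulrCA coefXM add0r.
Qed.

(** [(k n.+1).-1] is [k n] if [u n.+1] vanishes and [k n + 1] otherwise, so [k n] orders are
    available in either case. *)
Lemma chain_orthA_low n : orth L (k n) ('X * Rr n).
Proof.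
by apply: orth_leq (chain_orthA ch (n := n)); rewrite (chain_kS ch) /= leq_addr.
Qed.

(* Testing the orthogonality of ['X * Rr n] against [(C n - 1) / 'X]. *)
Lemma chain_normC n : l n.+1 * L (C n * C n) = 1.
Proof.
case: n => [|n].
  have := chain_LR ch 0; rewrite (chain_R0 ch) (chain_C0 ch) mulr1.
  by rewrite -[(_)%:P]mulr1 mul_polyC linearZ /= => /eqP; rewrite mulNr eqr_opp => /eqP.
have [g gE] : exists g, C n.+1 = g * 'X + 1.
  have [c0 c1] := (chain_C_at0 n.+1, factor_theorem (C n.+1 - 1) 0).
  have /c1[g] : root (C n.+1 - 1) 0.
    by rewrite /root hornerD hornerN hornerC horner_coef0 c0 subrr.
  by rewrite subr0 => e; exists g; rewrite -e subrK.
have sg : (size g <= k n.+1)%N.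
  have := chain_sizeC n.+1; rewrite gE size_MXaddC oner_eq0 andbF => -[<-] //.
have H : L ('X * Rr n.+1 * g) = 0.
  by apply: orthM sg; apply: chain_orthA_low.
have E : 'X * Rr n.+1 * g =
   - l n.+2 *: (C n.+1 * C n.+1) + C n.+1 * Rr n + l n.+2 *: C n.+1 - Rr n.
  transitivity ((C n.+1 - 1) * Rr n.+1); first by rewrite gE; ring.
  by rewrite (chain_RS ch) -!mul_polyC; ring.
move: H; rewrite E linearB !linearD !linearZ /= (chain_LR ch).
rewrite (orthM (q := Rr n) (chain_orthC ch (n := n.+1))); last by rewrite chain_sizeR
  chain_k_lt.
rewrite (orth1 _ (chain_orthC ch (n := n.+1))) ?chain_k_gt0 //; lra.
Qed.

(** In [Rr n.+1 = - l n.+2 *: C n.+1 + Rr n] the last term has degree below [k n.+1] and pairs to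
    zero with [C n.+1]; [chain_normC] evaluates the first. *)
Lemma chain_pairing n : L (C n * Rr n) = -1.
Proof.
case: n => [|n]; first by rewrite (chain_C0 ch) mul1r (chain_LR ch).
rewrite (chain_RS ch) mulrDr linearD /= -scalerAr linearZ /= mulNr chain_normC.
by rewrite (orthM (chain_orthC ch (n := n.+1))) ?addr0 // chain_sizeR chain_k_lt.
Qed.

(** Expand [C n.+1] by its recursion in [L (C n.+1 * Rr n) = 0]. As [u n.+1] is non-zero,
    ['X * Rr n] is orthogonal to [Rr n]; [chain_pairing] evaluates the last term. *)
Lemma chain_normA n : u n.+1 != 0 -> u n.+1 * L (('X * Rr n) * ('X * Rr n)) = 1.
Proof.
move=> u0; have H : L (C n.+1 * Rr n) = 0.
  by apply: (orthM (chain_orthC ch (n := n.+1))); rewrite chain_sizeR chain_k_lt.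
move: H; rewrite (chain_CS ch).
have -> : (((u n.+1)%:P * 'X + (w n.+1)%:P) * ('X * Rr n) + C n) * Rr n =
  u n.+1 *: (('X * Rr n) * ('X * Rr n)) + w n.+1 *: (('X * Rr n) * Rr n) + C n * Rr n.
  by rewrite -!mul_polyC; ring.
rewrite !linearD !linearZ /= chain_pairing.
rewrite (orthM (q := Rr n) (chain_orthA ch (n := n))); first lra.
by rewrite chain_sizeR (chain_kS ch) u0 addn1.
Qed.

End Chain.

(** * Construction of a chain for a positive definite functional *)

Section ChainExists.
Variables (R : realFieldType) (L : {scalar {poly R}}).
Hypothesis pd : positive_definite L.

Implicit Types st : {poly R} * {poly R}.

Let deg st := (size st.1).-1.
Let wt st := (L (st.1 * st.1))^-1.

(* Either [omega_n] alone suffices for the next denominator to be orthogonal to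
   one more power of ['X], or [upsilon_n] is needed and two powers are gained. *)
Let step_u st :=
  if L ('X * st.2 * 'X^(deg st)) == 0 then (L (('X * st.2) * ('X * st.2)))^-1
  else 0.
Let step_w st :=
  let A := 'X * st.2 in let d := deg st in
  if L (A * 'X^d) == 0
  then - ((step_u st * L (A * 'X^(d.+2)) + L (st.1 * 'X^(d.+1)))
           / L (A * 'X^(d.+1)))
  else - (L (st.1 * 'X^d) / L (A * 'X^d)).
Let step_C st :=
  ((step_u st)%:P * 'X + (step_w st)%:P) * ('X * st.2) + st.1.
Let step st := (step_C st, - (L (step_C st * step_C st))^-1 *: step_C st + st.2).
Let start : {poly R} * {poly R} := (1, (- (L 1)^-1)%:P).
Let states n := iter n step start.

Let good st := [/\ size st.1 = (deg st).+1, size st.2 = (deg st).+1,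
  L st.2 = -1 & L (st.1 * st.2) = -1] /\
  [/\ st.1`_0 = 1, orth L (deg st) st.1 & orth L (deg st) ('X * st.2)].

Let next_good st : good st ->
  [/\ good (step st), deg (step st) = (deg st + (step_u st != 0)).+1,
   0 <= step_u st, (step_u st != 0) || (step_w st != 0)
   & orth L (deg (step st)).-1 ('X * st.2)].
Proof.
case: st => C Rr; rewrite /good /=; set d := deg (C, Rr).
move=> [[sC sR LR LCR] [C0 oC oA]].
set st := (C, Rr).
have nC : C != 0 by rewrite -size_poly_gt0 sC.
have nA : 'X * Rr != 0.
  by rewrite mulf_neq0 ?polyX_eq0 // -size_poly_gt0 sR.
have sA : size ('X * Rr) = d.+2.
  by rewrite mulrC size_mulX ?sR // -size_poly_gt0 sR.
have LCC : 0 < L (C * C) by apply: pd.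
have LAA : 0 < L (('X * Rr) * ('X * Rr)) by apply: pd.
have LCd : L (C * 'X^d) != 0.
  apply: contraTneq LCC => e.
  by rewrite (orthM_lead oC) ?sC // e mulr0 ltxx.
have coefA i : ('X * Rr)`_i.+1 = Rr`_i by rewrite mulrC coefMX.
have lCR : Rr`_d * L (C * 'X^d) = -1.
  by rewrite -(orthM_lead oC) ?sR.
(* Either [w] alone cancels the pairing with ['X^d], or ['X * Rr] is itself orthogonal to ['X^d];
   then [u] cancels the pairing with ['X^d] by means of [L ('X * Rr * 'X^(d.+1))], and [w] the one
   with ['X^(d.+1)]. *)
have key : [/\ step_u st = 0, step_w st != 0 & orth L d.+1 (step_C st)] \/
    [/\ 0 < step_u st, orth L d.+1 ('X * Rr) & orth L d.+2 (step_C st)].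
  have E i : step_C st * 'X^i = step_u st *: ('X * Rr * 'X^(i.+1))
      + step_w st *: ('X * Rr * 'X^i) + C * 'X^i.
    by rewrite /step_C /= -!mul_polyC exprS; ring.
  have LE i : L (step_C st * 'X^i) = step_u st * L ('X * Rr * 'X^(i.+1))
      + step_w st * L ('X * Rr * 'X^i) + L (C * 'X^i).
    by rewrite E !linearD !linearZ.
  have [e|ne] := eqVneq (L ('X * Rr * 'X^d)) 0.
    right; have oA' : orth L d.+1 ('X * Rr).
      by move=> i; rewrite ltnS leq_eqVlt => /predU1P[-> //|]; apply: oA.
    have eu : step_u st = (L (('X * Rr) * ('X * Rr)))^-1.
      by rewrite /step_u /= -/d e eqxx.
    have LAAd : L (('X * Rr) * ('X * Rr)) = Rr`_d * L ('X * Rr * 'X^(d.+1)).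
      by rewrite (orthM_lead oA') ?sA // coefA.
    have nz : L ('X * Rr * 'X^(d.+1)) != 0.
      by apply: contraTneq LAA => z; rewrite LAAd z mulr0 ltxx.
    have nR : Rr`_d != 0.
      by apply: contraTneq LAA => z; rewrite LAAd z mul0r ltxx.
    have ew : step_w st = - ((step_u st * L ('X * Rr * 'X^(d.+2)) + L (C * 'X^(d.+1)))
           / L ('X * Rr * 'X^(d.+1))).
      by rewrite /step_w /= -/d e eqxx.
    split=> //; first by rewrite eu invr_gt0.
    move=> i; rewrite ltnS LE leq_eqVlt => /predU1P[->|].
      by rewrite ew mulNr divfK //; ring.
    rewrite ltnS leq_eqVlt => /predU1P[->|id].
      rewrite (oA' d) // mulr0 addr0 eu LAAd.
      have -> : L (C * 'X^d) = - (Rr`_d)^-1.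
        by apply: (mulfI nR); rewrite lCR mulrN divff.
      by field; rewrite nR nz.
    have i1 : (i < d.+1)%N by apply: ltnW.
    by rewrite (oA' i.+1) // (oA' i i1) (oC i id) !mulr0 !addr0.
  left; have eu : step_u st = 0 by rewrite /step_u /= -/d (negbTE ne).
  have ew : step_w st = - (L (C * 'X^d) / L ('X * Rr * 'X^d)).
    by rewrite /step_w /= -/d (negbTE ne).
  split=> //; first by rewrite ew oppr_eq0 mulf_neq0 ?invr_eq0.
  move=> i; rewrite LE eu mul0r add0r ltnS leq_eqVlt => /predU1P[->|id].
    by rewrite ew mulNr divfK // addrC subrr.
  by rewrite oA // oC // mulr0 addr0.
have uw : (step_u st != 0) || (step_w st != 0).
  by case: key => [[_ -> _]|[/gt_eqF-> _ _]]; rewrite ?orbT.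
have sC' : size (step_C st) = (d + (step_u st != 0)).+2.
  have su := size_affine uw.
  have sP : size (((step_u st)%:P * 'X + (step_w st)%:P) * ('X * Rr)) =
      (d + (step_u st != 0)).+2.
    by rewrite size_mul // -?size_poly_gt0 ?su // sA addSn addnC !addSn.
  by rewrite /step_C size_polyDl // sP sC !ltnS leq_addr.
have dE : deg (step st) = (d + (step_u st != 0)).+1 by rewrite /deg /= sC'.
have oC' : orth L (deg (step st)) (step_C st).
  rewrite dE; case: key => [[-> _]|[/gt_eqF-> _]]; rewrite ?eqxx ?addn0 ?addn1 //.
have oA' : orth L (deg (step st)).-1 ('X * Rr).
  by rewrite dE; case: key => [[-> _]|[/gt_eqF-> + _]]; rewrite ?eqxx ?addn0 ?addn1.
have LCC' : 0 < L (step_C st * step_C st) by apply: pd; rewrite -size_poly_gt0 sC'.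
have LC'1 : L (step_C st) = 0 by apply: orth1 oC'; rewrite dE.
have LC'R : L (step_C st * Rr) = 0.
  by apply: orthM oC' _; rewrite sR dE ltnS leq_addr.
have c0 : (step_C st)`_0 = 1 by rewrite /step_C coefD C0 mulrCA coefXM add0r.
have sZ : size (- (L (step_C st * step_C st))^-1 *: step_C st) = (deg (step st)).+1.
  by rewrite size_scale ?oppr_eq0 ?invr_eq0 ?gt_eqF // sC' dE.
have sRC : (size Rr < (deg (step st)).+1)%N by rewrite sR dE !ltnS leq_addr.
split; [split; split | | | |] => //=.
- by rewrite sC' dE.
- by rewrite size_polyDl sZ // sZ.
- by rewrite linearD linearZ /= LC'1 mulr0 add0r.
- by rewrite mulrDr linearD /= LC'R -scalerAr linearZ /= mulNr mulVf ?gt_eqF // addr0.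
(* The recursion for [R'] yields every relation but the last. That one comes from testing ['X * R']
   against [g = (C' - 1) / 'X], with [C'] the new first component: the coefficient of [C'] in [R']
   makes [L ((C' - 1) * R')] vanish, and [g] has exactly the degree of the missing power. *)
- have [g gE] : exists g, step_C st = g * 'X + 1.
    have /factor_theorem[g] : root (step_C st - 1) 0.
      by rewrite /root hornerD hornerN hornerC horner_coef0 c0 subrr.
    by rewrite subr0 => e; exists g; rewrite -e subrK.
  have sg : (size g).+1 = (deg (step st)).+1.
    have := sC'; rewrite -dE gE size_MXaddC oner_eq0 andbF => -[->].
    by rewrite dE.
  set R' := _ + Rr.
  have sP i : (i < deg (step st))%N -> L ('X * R' * 'X^i) =
     - (L (step_C st * step_C st))^-1 * L (step_C st * 'X^(i.+1)) + L ('X * Rr * 'X^i).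
    move=> _; rewrite -linearZ -linearD; congr (L _).
    by rewrite /R' -!mul_polyC exprS; ring.
  have low : orth L (deg (step st)).-1 ('X * R').
    move=> i id; have id' : (i.+1 < deg (step st))%N by move: id; rewrite dE.
    by rewrite sP ?(ltnW id') // oC' // oA' // mulr0 addr0.
  have full : L ('X * R' * g) = 0.
    have -> : 'X * R' * g = - (L (step_C st * step_C st))^-1 *: (step_C st * step_C st)
       + (L (step_C st * step_C st))^-1 *: step_C st + step_C st * Rr - Rr.
      transitivity ((step_C st - 1) * R'); first by rewrite gE; ring.
      by rewrite /R' -!mul_polyC; ring.
    have lin (B : {poly R}) c : L (- c *: (B * B) + c *: B + B * Rr - Rr) =
        - c * L (B * B) + c * L B + L (B * Rr) - L Rr.
      by rewrite linearB !linearD !linearZ.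
    rewrite lin LC'1 LC'R LR mulNr mulVf ?gt_eqF //.
    by rewrite mulr0 !addr0 opprK addrC subrr.
  have gd : g`_(deg (step st)).-1 != 0.
    have : lead_coef g != 0.
      by rewrite lead_coef_eq0 -size_poly_gt0; move: sg; rewrite dE; case: (size g).
    by rewrite lead_coefE; case: sg => ->.
  have top : L ('X * R' * 'X^((deg (step st)).-1)) = 0.
    move: full; rewrite (orthM_lead low); last by case: sg => ->; rewrite dE.
    by move/eqP; rewrite mulf_eq0 (negbTE gd) => /eqP.
  move=> i id; have [lt|] := ltnP i (deg (step st)).-1; first exact: low.
  move=> ge; suff -> : i = (deg (step st)).-1 by [].
  by apply/eqP; rewrite eqn_leq ge andbT; move: id; rewrite dE.
- by case: key => [[-> //]|[/ltW]].
Qed.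

Lemma chain_exists : exists C Rr u w l k,
  chain L C Rr u w l k /\ forall n, 0 <= u n.+1.
Proof.
have L1 : 0 < L 1 by have := pd (oner_neq0 _); rewrite mulr1.
have good_states n : good (states n).
  elim: n => [|n IH]; last by case: (next_good IH).
  have d0 : deg start = 0%N by rewrite /deg /= size_poly1.
  have nL : - (L 1)^-1 != 0 by rewrite oppr_eq0 invr_eq0 gt_eqF.
  rewrite /states /good /= d0 /wt; split; split=> //=.
  - by rewrite size_poly1.
  - by rewrite size_polyC nL.
  - by rewrite -[_%:P]mulr1 mul_polyC linearZ /= mulNr mulVf ?gt_eqF.
  - by rewrite mul1r -[_%:P]mulr1 mul_polyC linearZ /= mulNr mulVf ?gt_eqF.
  - by rewrite coef1.
(* The step from state [n] produces [u n.+1] and [w n.+1], and state [n] itself fixes [l n.+1];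
   hence [n.-1]. *)
exists (fun n => (states n).1), (fun n => (states n).2),
  (fun n => step_u (states n.-1)), (fun n => step_w (states n.-1)),
  (fun n => wt (states n.-1)), (fun n => deg (states n)).
split; last by move=> n /=; case: (next_good (good_states n)).
split=> //=.
- by rewrite /wt /= mulr1.
- by rewrite /deg size_poly1.
- by move=> n; case: (next_good (good_states n)).
- move=> n; rewrite invr_gt0; apply: pd.
  by have [[s _ _ _] _] := good_states n; rewrite -size_poly_gt0 s.
- by move=> n; case: (next_good (good_states n)).
- by move=> n; case: (good_states n) => _ [].
- by move=> n; case: (next_good (good_states n)).
- by move=> n; case: (good_states n) => [[]].
Qed.

End ChainExists.

(** * Hankel determinants *)

Section Hankel.
Variable R : realFieldType.

Definition hankel (t : nat -> R) n := \det (\matrix_(p < n, q < n) t (p + q)%N).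

(** Cramer's rule via the adjugate, in a form that covers singular [M]. *)
Lemma cramer_entry n (M : 'M[R]_n.+1) (c : 'cV_n.+1) x i j :
  M *m c = x *: delta_mx i 0 -> c j 0 * \det M = x * cofactor M i j.
Proof.
move=> /(congr1 (mulmx (\adj M))).
rewrite mulmxA mul_adj_mx -scalemxAr mul_scalar_mx => /(congr1 (fun A : 'cV_n.+1 => A j 0)).
by rewrite mxE mulrC => ->; rewrite mxE -colE !mxE.
Qed.

(** Removing a border row and a border column leaves a Hankel matrix, whose shift is the number of
    removed initial rows and columns. *)
Lemma cofactor_hankel00 t n :
  cofactor (\matrix_(p < n.+1, q < n.+1) t (p + q)%N) 0 0 =
  hankel (fun i => t i.+2) n.
Proof.
rewrite /cofactor expr0 mul1r; congr (\det _); apply/matrixP => i j.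
by rewrite !mxE !lift0 addSn addnS.
Qed.

Lemma cofactor_hankel_max0 t n :
  cofactor (\matrix_(p < n.+1, q < n.+1) t (p + q)%N) ord_max 0 =
  (-1) ^+ n * hankel (fun i => t i.+1) n.
Proof.
rewrite /cofactor addn0; congr (_ * \det _); apply/matrixP => i j.
by rewrite !mxE lift0 lift_max addnS.
Qed.

Lemma cofactor_hankel_max t n :
  cofactor (\matrix_(p < n.+1, q < n.+1) t (p + q)%N) ord_max ord_max = hankel t n.
Proof.
rewrite /cofactor addnn -signr_odd odd_double mul1r; congr (\det _).
by apply/matrixP => i j; rewrite !mxE !lift_max.
Qed.

End Hankel.

(** * Determinant formulas for the constants of a chain *)

Section HankelChain.
Variables (R : realFieldType) (L : {scalar {poly R}}) (t : nat -> R).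
Hypothesis Lt : forall i, L 'X^i = t i.+2.
Hypothesis pd : positive_definite L.

(** [t i] is the moment [s_(i-2)], so [D0], [D1], [Dm1], [Dm2] have top-left entries [s_0], [s_1],
    [s_(-1)], [s_(-2)]. *)
Let D0 := hankel (fun i => t i.+2).
Let D1 := hankel (fun i => t i.+3).
Let Dm1 := hankel (fun i => t i.+1).
Let Dm2 := hankel t.

(* [Lm1 p] stands for [L (p / 'X)], where [L 'X^-1] is taken to be [t 1]. *)
Let Lm1 (p : {poly R}) := p`_0 * t 1%N + L (drop_poly 1 p).

Let Lm1X q : Lm1 ('X * q) = L q.
Proof. by rewrite /Lm1 coefXM mul0r add0r mulrC -['X]expr1 drop_polyMXn_id. Qed.

Let Lm1D p q : Lm1 (p + q) = Lm1 p + Lm1 q.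
Proof. by rewrite /Lm1 coefD drop_polyD linearD /=; ring. Qed.

Let L_coef (p : {poly R}) n j : (size p <= n)%N -> L (p * 'X^j) = \sum_(i < n) p`_i * t
  (i + j).+2.
Proof.
move=> sp; rewrite mulrC (functional_expand _ _ sp); apply: eq_bigr => i _.
by rewrite -exprD Lt addnC.
Qed.

Let Lm1_coef (p : {poly R}) n : (size p <= n)%N -> Lm1 p = \sum_(i < n) p`_i * t i.+1.
Proof.
case: n => [|n] sp.
  have /eqP-> : p == 0 by rewrite -size_poly_leq0.
  by rewrite /Lm1 coef0 mul0r (drop_poly_eq0 (m := 1)) ?size_poly0 // linear0 addr0
    big_ord0.
rewrite /Lm1 big_ord_recl; congr (_ + _).
rewrite -[drop_poly _ _]mulr1 -(expr0 'X) (L_coef (n := n)) ?size_drop_poly ?leq_subLR //.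
by apply: eq_bigr => i _; rewrite coef_drop_poly addn1 addn0 lift0.
Qed.

(** A vector in the left kernel is the coefficient vector of [p], and its products with the columns
    are the values [L ('X^m * p * 'X^j)]. *)
Lemma hankel_eq0P m n : reflect
  (exists p : {poly R}, [/\ p != 0, (size p <= n)%N & orth L n ('X^m * p)])
  (hankel (fun i => t (m + i).+2) n == 0).
Proof.
have E (v : 'rV[R]_n) j :
    (v *m \matrix_(p < n, q < n) t (m + (p + q)).+2) 0 j = L ('X^m * rVpoly v * 'X^j).
  rewrite !mxE mulrAC -exprD mulrC (L_coef _ (size_poly _ _)).
  by apply: eq_bigr => i _; rewrite !mxE coef_rVpoly_ord addnCA.
apply: (iffP det0P) => [[v v0 ve]|[p [p0 sp op]]].
  exists (rVpoly v); split; last 1 first.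
  - by move=> i lti; rewrite -(E v (Ordinal lti)) ve mxE.
  - apply: contraNneq v0 => e.
    by rewrite -(rVpolyK v) e linear0.
  - exact: size_poly.
exists (poly_rV p).
  by apply: contraNneq p0 => e; rewrite -(poly_rV_K sp) e linear0.
by apply/rowP => j; rewrite E poly_rV_K // mxE op.
Qed.

Lemma hankel0_neq0 n : D0 n != 0.
Proof.
apply/negP => /(hankel_eq0P 0)[p [p0 sp]]; rewrite mul1r => op.
by move: p0; rewrite (orth_eq0 pd op sp) eqxx.
Qed.

Variables (C Rr : nat -> {poly R}) (u w l : nat -> R) (k : nat -> nat).
Hypothesis ch : chain L C Rr u w l k.

(** A singular matrix gives [p] of degree below [k n] with ['X * p] orthogonal to as many powers as
    [C n]. Subtracting the multiple of [C n] with the same coefficient of degree [k n] leaves zero,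
    by positivity. The constant term then shows that the multiple is zero, so ['X * p = 0]. *)
Lemma hankel1_chain_neq0 n : D1 (k n) != 0.
Proof.
apply/negP => /(hankel_eq0P 1)[p [p0 sp]]; rewrite expr1 => op.
pose r := 'X * p - p`_(k n).-1 / (C n)`_(k n) *: C n.
have lC : (C n)`_(k n) != 0.
  have : lead_coef (C n) != 0 by rewrite lead_coef_eq0 -size_poly_gt0 (chain_sizeC ch).
  by rewrite lead_coefE (chain_sizeC ch).
have r0 : r = 0.
  apply: (@orth_eq0 _ L (k n) r pd).
    move=> i ik; rewrite /r mulrBl linearB /= op // -scalerAl linearZ /=.
    by rewrite (chain_orthC ch) // mulr0 subrr.
  apply/leq_sizeP => j; rewrite leq_eqVlt => /predU1P[<-|kj].
    rewrite coefB coefZ divfK // coefXM; case: eqP => [k0|_]; last by rewrite subrr.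
    by rewrite sub0r nth_default ?oppr0 // (leq_trans sp) // k0.
  have k1 : (k n < j.-1.+1)%N by rewrite prednK // (leq_trans _ kj).
  rewrite coefB coefXM coefZ; case: eqP => [j0|_]; first by rewrite j0 in kj.
  rewrite [(C n)`_j]nth_default ?(chain_sizeC ch) // mulr0 subr0.
  by rewrite nth_default // (leq_trans sp).
have c0 : p`_(k n).-1 / (C n)`_(k n) = 0.
  have := congr1 (fun q : {poly R} => q`_0) r0.
  rewrite coefB coefXM coefZ (chain_C_at0 ch) coef0 mulr1 sub0r => /eqP.
  by rewrite oppr_eq0 => /eqP.
move: r0; rewrite /r c0 scale0r subr0 => /eqP.
by rewrite mulf_eq0 polyX_eq0 (negbTE p0).
Qed.

(** Only [k n + 1] can lie strictly between, when [u n.+1] is non-zero; there [Rr n] gives a kernel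
    vector, since ['X * Rr n] has one more order of orthogonality. *)
Lemma hankel1_gap n j : (k n < j < k n.+1)%N -> D1 j = 0.
Proof.
rewrite (chain_kS ch) => /andP[lt1 lt2].
have u0 : u n.+1 != 0 by move: lt2; case: eqP => //= _; rewrite addn0 ltnS leqNgt lt1.
have jE : j = (k n).+1.
  by apply/eqP; rewrite eqn_leq lt1 andbT; move: lt2; rewrite u0 addn1.
apply/eqP/(hankel_eq0P 1); exists (Rr n); split.
- by rewrite -size_poly_gt0 (chain_sizeR ch).
- by rewrite (chain_sizeR ch) jE.
- by have := chain_orthA ch (n := n); rewrite (chain_kS ch) u0 addn1 -jE expr1.
Qed.

(** By orthogonality the Hankel matrix maps the coefficients of [C n] to a multiple of the last unit
    vector. Cramer's rule for the constant coefficient, which is 1, and for the leading one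
    expresses [L (C n * C n)] by determinants; [chain_normC] turns this into [l n.+1]. *)
Lemma chain_lE n : l n.+1 = D1 (k n) ^+ 2 / (D0 (k n) * D0 (k n + 1)%N).
Proof.
rewrite addn1; set d := k n; set h := L (C n * 'X^d).
have e : (\matrix_(p < d.+1, q < d.+1) t (p + q).+2) *m (\col_i (C n)`_i)
    = h *: delta_mx ord_max 0.
  apply/colP => p; rewrite !mxE eqxx andbT.
  transitivity (L (C n * 'X^p)).
    rewrite (L_coef (n := d.+1)) ?(chain_sizeC ch) //.
    by apply: eq_bigr => i _; rewrite !mxE mulrC addnC.
  case: (eqVneq p ord_max) => [->|np] /=; first by rewrite mulr1.
  rewrite mulr0 (chain_orthC ch) // -/d.
  by rewrite ltn_neqAle -ltnS ltn_ord andbT -[X in _ != X]/(val (@ord_max d)) val_eqE.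
have e0 : D0 d.+1 = h * ((-1) ^+ d * D1 d).
  have := cramer_entry 0 e; rewrite (cofactor_hankel_max0 (fun i => t i.+2)) mxE.
  by rewrite (chain_C_at0 ch) mul1r.
have em : (C n)`_d * D0 d.+1 = h * D0 d.
  by have := cramer_entry ord_max e; rewrite (cofactor_hankel_max (fun i => t i.+2)) mxE.
have n0 := hankel0_neq0 d; have n0' := hankel0_neq0 d.+1.
have n1 : D1 d != 0 := hankel1_chain_neq0 n.
have LCC : L (C n * C n) = (C n)`_d * h.
  by rewrite (orthM_lead (chain_orthC ch (n := n))) ?(chain_sizeC ch).
have sg : ((-1) ^+ d : R) ^+ 2 = 1 by rewrite -exprM mulnC exprM sqrrN expr1n expr1n.
have LCCE : L (C n * C n) * D1 d ^+ 2 = D0 d * D0 d.+1.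
  rewrite LCC; apply: (mulIf n0').
  transitivity ((C n)`_d * D0 d.+1 * h * D1 d ^+ 2); first by ring.
  transitivity (h ^+ 2 * (((-1) ^+ d : R) ^+ 2) * D1 d ^+ 2 * D0 d).
    by rewrite em sg; ring.
  by rewrite e0; ring.
have := chain_normC ch n; rewrite -LCCE => nrm.
have nz : L (C n * C n) != 0.
  by apply: contraTneq isT => z; move: nrm; rewrite z mulr0 => /eqP; rewrite eq_sym
    oner_eq0.
apply: (mulIf nz); rewrite nrm; field.
by rewrite nz n1.
Qed.

Let Dm1E n : Dm1 (k n + 1)%N = Lm1 (C n) * D1 (k n).
Proof.
rewrite addn1; set d := k n.
have e : (\matrix_(p < d.+1, q < d.+1) t (p + q).+1) *m (\col_i (C n)`_i)
    = Lm1 (C n) *: delta_mx 0 0.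
  apply/colP => p; rewrite !mxE eqxx andbT.
  transitivity (\sum_(i < d.+1) (C n)`_i * t (i + p).+1).
    by apply: eq_bigr => i _; rewrite !mxE mulrC addnC.
  case: (eqVneq p 0) => [->|np] /=.
    rewrite mulr1 (@Lm1_coef _ d.+1) ?(chain_sizeC ch) //.
    by apply: eq_bigr => i _; rewrite addn0.
  have [j pj] : exists j, val p = j.+1.
    by exists (val p).-1; rewrite prednK // lt0n.
  rewrite mulr0; transitivity (L (C n * 'X^j)); last first.
    by rewrite (chain_orthC ch) // -ltnS -pj ltn_ord.
  rewrite (L_coef (n := d.+1)) ?(chain_sizeC ch) //.
  by apply: eq_bigr => i _; rewrite pj addnS.
have := cramer_entry 0 e; rewrite (cofactor_hankel00 (fun i => t i.+1)) mxE /=.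
by rewrite (chain_C_at0 ch) mul1r.
Qed.

(** The quotients are [Lm1 (C n)] and [Lm1 (C n.+1)]. By the recursion they differ by [L] of
    [(u 'X + w) Rr n], where [L (Rr n) = -1], and ['X * Rr n] is orthogonal to 1 if [u n.+1] is
    non-zero. *)
Lemma chain_wE n : w n.+1 =
  Dm1 (k n + 1)%N / D1 (k n) - Dm1 (k n.+1 + 1)%N / D1 (k n.+1).
Proof.
rewrite !Dm1E !mulfK ?hankel1_chain_neq0 // (chain_CS ch) Lm1D.
rewrite [_ * ('X * _)]mulrCA Lm1X opprD addrCA subrr addr0.
have -> : ((u n.+1)%:P * 'X + (w n.+1)%:P) * Rr n =
   u n.+1 *: ('X * Rr n) + w n.+1 *: Rr n by rewrite -!mul_polyC; ring.
rewrite linearD !linearZ /= (chain_LR ch) mulrN1 opprD opprK.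
have [->|u0] := eqVneq (u n.+1) 0; first by rewrite mul0r oppr0 add0r.
rewrite (orth1 _ (chain_orthA ch (n := n))) ?mulr0 ?oppr0 ?add0r //.
by rewrite (chain_kS ch) u0 addn1.
Qed.

(** As [f] represents the values [- t i.+1], in the product of the matrix with the coefficients of
    [1 + 'X * f] every row but the first cancels. *)
Let Dm2E n (f : {poly R}) : (size f <= n)%N ->
  (forall i, (i < n)%N -> L (f * 'X^i) = - t i.+1) ->
  Dm2 n.+1 = (t 0%N + Lm1 f) * D0 n.
Proof.
move=> sf Lf; pose F := 1 + 'X * f.
have F0 : F`_0 = 1 by rewrite coefD coef1 coefXM addr0.
have e : (\matrix_(p < n.+1, q < n.+1) t (p + q)%N) *m (\col_i F`_i)
    = (t 0%N + Lm1 f) *: delta_mx 0 0.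
  apply/colP => p; rewrite !mxE eqxx andbT big_ord_recl !mxE F0 mulr1 addn0.
  transitivity (t p + \sum_(i < n) f`_i * t (i + p).+1).
    congr (_ + _); apply: eq_bigr => i _; rewrite !mxE lift0 coefD coef1 coefXM add0r.
    by rewrite mulrC addnS addnC.
  case: (eqVneq p 0) => [->|np] /=.
    rewrite mulr1 (Lm1_coef sf); congr (_ + _).
    by apply: eq_bigr => i _; rewrite addn0.
  have [j pj] : exists j, val p = j.+1.
    by exists (val p).-1; rewrite prednK // lt0n.
  rewrite mulr0; have jn : (j < n)%N by rewrite -ltnS -pj ltn_ord.
  have := Lf j jn; rewrite (L_coef _ sf) -pj => E.
  under eq_bigr do rewrite pj addnS.
  by rewrite E subrr.
have := cramer_entry 0 e; rewrite cofactor_hankel00 mxE /= F0 mul1r //.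
Qed.

Let representative n : exists2 f : {poly R}, (size f <= n)%N &
  forall i, (i < n)%N -> L (f * 'X^i) = - t i.+1.
Proof.
pose M := \matrix_(p < n, q < n) t (p + q).+2.
have uM : M \in unitmx by rewrite unitmxE unitfE hankel0_neq0.
pose v := (\row_(j < n) - t j.+1) *m invmx M.
exists (rVpoly v); first exact: size_poly.
move=> i lti; have : (v *m M) 0 (Ordinal lti) = - t i.+1 by rewrite mulmxKV // mxE.
move=> <-; rewrite mxE (L_coef _ (size_poly _ _)).
by apply: eq_bigr => j _; rewrite coef_rVpoly_ord; congr (_ * _); rewrite mxE.
Qed.

(** If [u n.+1 = 0] the quotients coincide. Otherwise they are [t 0 + Lm1 f] and [t 0 + Lm1 g] for
    polynomials representing [- t i.+1] on [k n + 1] and [k n + 2] powers; [g] is [f] plus [u n.+1]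
    times ['X * Rr n], and [Lm1] of this addition is [- u n.+1]. *)
Lemma chain_uE n : u n.+1 =
  Dm2 (k n + 2)%N / D0 (k n + 1)%N - Dm2 (k n.+1 + 1)%N / D0 (k n.+1).
Proof.
rewrite (chain_kS ch) !addn1 addn2.
have [u0|u0] := eqVneq (u n.+1) 0; first by rewrite u0 addn0 subrr.
rewrite addn1; set d := (k n).+1.
have [f sf Lf] := representative d.
have [sA oA] : size ('X * Rr n) = d.+1 /\ orth L d ('X * Rr n).
  split; first by rewrite (chain_sizeA ch).
  by have := chain_orthA ch (n := n); rewrite (chain_kS ch) u0 addn1.
have nA := chain_normA ch u0; set A := 'X * Rr n in sA oA nA.
have Lm1_opp i : t i.+1 = Lm1 'X^i.
  case: i => [|i]; last by rewrite exprS Lm1X Lt.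
  rewrite expr0 /Lm1 coef1 mul1r drop_poly_eq0 ?linear0 ?addr0 // size_poly1 //.
pose g := f + u n.+1 *: A.
have sg : (size g <= d.+1)%N.
  rewrite (leq_trans (size_polyD _ _)) // geq_max (leq_trans sf) //=.
  by rewrite (leq_trans (size_scale_leq _ _)) // sA.
have Lg i : (i < d.+1)%N -> L (g * 'X^i) = - t i.+1.
  rewrite ltnS leq_eqVlt => /predU1P[->|id]; last first.
    by rewrite mulrDl linearD /= Lf // -scalerAl linearZ /= oA // mulr0 addr0.
  (* The relation at ['X^d] is checked after multiplication by the leading coefficient of [A], by
     combining [L (f * A) = 0], [Lm1 A = -1] and the norm of [A]. *)
  have lA : A`_d != 0.
    have : lead_coef A != 0 by rewrite lead_coef_eq0 -size_poly_gt0 sA.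
    by rewrite lead_coefE sA.
  have fA : L (f * A) = \sum_(i < d) A`_i * - t i.+1 + A`_d * L (f * 'X^d).
    rewrite (@functional_expand _ L f A d.+1) ?sA // big_ord_recr /=.
    by congr (_ + _); apply: eq_bigr => j _; rewrite Lf.
  have fA0 : L (f * A) = 0 by rewrite mulrC (orthM oA).
  have LA : Lm1 A = -1 by rewrite Lm1X (chain_LR ch).
  move: LA; rewrite (@Lm1_coef _ d.+1) ?sA // big_ord_recr /= => LA.
  have nA' : u n.+1 * (A`_d * L (A * 'X^d)) = 1.
    by rewrite -[RHS]nA (orthM_lead (q := A) oA) ?sA.
  apply: (mulfI lA); rewrite mulrDl linearD /= -scalerAl linearZ /= mulrDr.
  rewrite [A`_d * (_ * _)]mulrCA nA'.
  move: fA; rewrite fA0; under eq_bigr do rewrite mulrN.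
  rewrite sumrN; move: LA; lra.
rewrite (Dm2E sf Lf) (Dm2E sg Lg) !mulfK ?hankel0_neq0 // /g Lm1D.
have -> : Lm1 (u n.+1 *: A) = - u n.+1.
  by rewrite /A scalerAr Lm1X linearZ /= (chain_LR ch) mulrN1.
by lra.
Qed.

End HankelChain.

(** * Stieltjes transforms *)

Section Measure.
Variables (R : realType) (rho : {measure set (measurableTypeR R) -> \bar R}).
Implicit Types (f g : R -> R) (p q : {poly R}) (z : R[i]).

Definition integrableR f := rho.-integrable setT (EFin \o f).

Lemma integrableRD f g : integrableR f -> integrableR g -> integrableR (fun x => f x + g x).
Proof. by move=> fi gi; exact: (integrableD measurableT fi gi). Qed.

Lemma integrableRZ c f : integrableR f -> integrableR (fun x => c * f x).
Proof. by move=> fi; exact: (integrableZl measurableT c fi). Qed.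

Lemma integrableR_dom f g : measurable_fun setT f -> (forall x, `|f x| <= `|g x|) ->
  integrableR g -> integrableR f.
Proof.
move=> mf fg; apply: le_integrable => //; first exact/measurable_EFinP.
by move=> x _; rewrite /= lee_fin.
Qed.

Lemma integrableR_measurable f : integrableR f -> measurable_fun setT f.
Proof. by move/measurable_int/measurable_EFinP. Qed.

Lemma integralRD f g : integrableR f -> integrableR g ->
  \int[rho]_x (f x + g x) = \int[rho]_x f x + \int[rho]_x g x.
Proof. by move=> fi gi; rewrite RintegralD. Qed.

Lemma integralRZ c f : integrableR f -> \int[rho]_x (c * f x) = c * \int[rho]_x f x.
Proof. by move=> fi; rewrite RintegralZl. Qed.

Lemma measurable_horner p : measurable_fun setT (fun x : R => p.[x]).
Proof. by apply: continuous_measurable_fun; exact: continuous_horner. Qed.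

Definition kernel_den z (x : R) := (x - complex.Re z) ^+ 2 + complex.Im z ^+ 2.
Definition kernel_re z (x : R) := (x - complex.Re z) / kernel_den z x.
Definition kernel_im z (x : R) := complex.Im z / kernel_den z x.

Lemma kernelE z (x : R) : (x%:C - z)^-1 = kernel_re z x +i* kernel_im z x.
Proof.
case: z => a b; rewrite /kernel_re /kernel_im /kernel_den /=; simpc.
by apply/eqP; rewrite eq_complex /= sqrrN mulNr opprK !eqxx.
Qed.

Lemma kernel_den_gt0 z x : nonreal z -> 0 < kernel_den z x.
Proof.
by rewrite /nonreal => y0; rewrite ltr_wpDl ?sqr_ge0 // exprn_even_gt0.
Qed.

Let measurable_den z : nonreal z -> measurable_fun setT (fun x : R => (kernel_den z x)^-1).
Proof.
move=> z0; apply: continuous_measurable_fun => x.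
apply: cvgV; first by rewrite gt_eqF // kernel_den_gt0.
have -> : kernel_den z = horner (('X - (complex.Re z)%:P) ^+ 2 + (complex.Im z ^+ 2)%:P).
  by apply/funext => y; rewrite /kernel_den !hornerE.
exact: continuous_horner.
Qed.

Lemma measurable_kernel_re z : nonreal z -> measurable_fun setT (kernel_re z).
Proof.
move=> z0; apply: measurable_funM (measurable_den z0).
by apply: measurable_funB => //; exact: measurable_id.
Qed.

Lemma measurable_kernel_im z : nonreal z -> measurable_fun setT (kernel_im z).
Proof. by move=> z0; apply: measurable_funM (measurable_den z0); exact: measurable_cst. Qed.

Lemma kernel_re_le z x : nonreal z -> `|kernel_re z x| <= `|complex.Im z|^-1.
Proof.
move=> z0; have d0 := kernel_den_gt0 x z0.
have y0 : 0 < `|complex.Im z| by rewrite normr_gt0.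
rewrite normrM normfV (gtr0_norm d0) ler_pdivrMr // mulrC ler_pdivlMr //.
rewrite /kernel_den -(real_normK (num_real (x - _))) -(real_normK (num_real (complex.Im
  z))).
by nra.
Qed.

Lemma kernel_im_le z x : nonreal z -> `|kernel_im z x| <= `|complex.Im z|^-1.
Proof.
move=> z0; have d0 := kernel_den_gt0 x z0.
have y0 : 0 < `|complex.Im z| by rewrite normr_gt0.
rewrite normrM normfV (gtr0_norm d0) ler_pdivrMr // mulrC ler_pdivlMr //.
rewrite /kernel_den -[in leRHS](real_normK (num_real (complex.Im z))) expr2.
by rewrite lerDr sqr_ge0.
Qed.

Lemma integrableR_kernel (h : R -> R) p z : nonreal z -> measurable_fun setT h ->
  (forall x, `|h x| <= `|complex.Im z|^-1) -> integrableR (horner p) ->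
  integrableR (fun x => p.[x] * h x).
Proof.
move=> z0 mh hb ip.
apply: (integrableR_dom _ _ (integrableRZ `|complex.Im z|^-1 ip)).
  by apply: measurable_funM mh; exact: measurable_horner.
move=> x; rewrite !normrM mulrC ler_wpM2r // (le_trans (hb x)) //.
by rewrite ger0_norm // invr_ge0.
Qed.

Lemma integrableR_kernel_re p z : nonreal z -> integrableR (horner p) ->
  integrableR (fun x => p.[x] * kernel_re z x).
Proof.
move=> z0; apply: (integrableR_kernel z0); first exact: measurable_kernel_re.
by move=> x; exact: kernel_re_le.
Qed.

Lemma integrableR_kernel_im p z : nonreal z -> integrableR (horner p) ->
  integrableR (fun x => p.[x] * kernel_im z x).
Proof.
move=> z0; apply: (integrableR_kernel z0); first exact: measurable_kernel_im.
by move=> x; exact: kernel_im_le.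
Qed.

Definition stieltjes p z : R[i] :=
  (\int[rho]_x (p.[x] * kernel_re z x)) +i* (\int[rho]_x (p.[x] * kernel_im z x)).

Lemma stieltjesD p q z : nonreal z -> integrableR (horner p) -> integrableR (horner q) ->
  stieltjes (p + q) z = stieltjes p z + stieltjes q z.
Proof.
move=> z0 ip iq; rewrite /stieltjes; simpc.
congr (_ +i* _); rewrite -integralRD; try exact: integrableR_kernel_re; try exact:
  integrableR_kernel_im.
- by apply: eq_Rintegral => x _; rewrite hornerD mulrDl.
- by apply: eq_Rintegral => x _; rewrite hornerD mulrDl.
Qed.

Lemma stieltjesZ c p z : nonreal z -> integrableR (horner p) ->
  stieltjes (c *: p) z = c%:C * stieltjes p z.
Proof.
move=> z0 ip; rewrite /stieltjes; simpc.
congr (_ +i* _); rewrite -integralRZ; try exact: integrableR_kernel_re; try exact: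
  integrableR_kernel_im.
- by apply: eq_Rintegral => x _; rewrite hornerZ -mulrA.
- by apply: eq_Rintegral => x _; rewrite hornerZ -mulrA.
Qed.

(** Integrated form of [x / (x - z) = z / (x - z) + 1]. *)
Lemma stieltjesMX p z : nonreal z -> integrableR (horner p) ->
  stieltjes ('X * p) z = z * stieltjes p z + (\int[rho]_x p.[x])%:C.
Proof.
move=> z0 ip; rewrite /stieltjes.
have ir := integrableR_kernel_re z0 ip; have ii := integrableR_kernel_im z0 ip.
case: z z0 ir ii => a b z0 ir ii; simpc.
have d0 x : kernel_den (a +i* b) x != 0 by rewrite gt_eqF ?kernel_den_gt0.
congr (_ +i* _).
- transitivity (\int[rho]_x (a * (p.[x] * kernel_re (a +i* b) x) +
      (- b * (p.[x] * kernel_im (a +i* b) x) + p.[x]))).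
    apply: eq_Rintegral => x _; rewrite /kernel_re /kernel_im !hornerE.
    by have := d0 x; rewrite /kernel_den /= => d; field; exact: d.
  have i1 := integrableRZ a ir; have i2 := integrableRZ (- b) ii; have i3 :=
    integrableRD i2 ip.
  by rewrite (integralRD i1 i3) (integralRD i2 ip) (integralRZ a ir) (integralRZ (- b)
    ii) mulNr addrA.
- transitivity (\int[rho]_x (a * (p.[x] * kernel_im (a +i* b) x) +
      b * (p.[x] * kernel_re (a +i* b) x))).
    apply: eq_Rintegral => x _; rewrite /kernel_re /kernel_im !hornerE.
    by have := d0 x; rewrite /kernel_den /= => d; field; exact: d.
  by rewrite (integralRD (integrableRZ a ii) (integrableRZ b ir)) (integralRZ a ii)
    (integralRZ b ir).
Qed.

Lemma stieltjes_conj p z : nonreal z -> integrableR (horner p) ->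
  stieltjes p z^*%C = (stieltjes p z)^*%C.
Proof.
move=> z0 ip.
have E (x : R) : kernel_re z^*%C x = kernel_re z x /\ kernel_im z^*%C x = - kernel_im z x.
  by case: (z) => a b; rewrite /kernel_re /kernel_im /kernel_den /= sqrrN mulNr.
rewrite /stieltjes /=; congr (_ +i* _).
  by apply: eq_Rintegral => x _; case: (E x) => ->.
rewrite -mulN1r -integralRZ; last exact: integrableR_kernel_im.
by apply: eq_Rintegral => x _; rewrite (E x).2 mulrN mulN1r.
Qed.

Lemma stieltjes_bound p y : 0 < y -> integrableR (horner p) ->
  `|complex.Re (stieltjes p (0 +i* y))| <= y^-1 * \int[rho]_x `|p.[x]| /\
  `|complex.Im (stieltjes p (0 +i* y))| <= y^-1 * \int[rho]_x `|p.[x]|.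
Proof.
move=> y0 ip; have z0 : nonreal (0 +i* y) by rewrite /nonreal /= gt_eqF.
have ia : integrableR (fun x => `|p.[x]|) by exact: (integrable_norm ip).
have bnd (h : R -> R) : integrableR (fun x => p.[x] * h x) ->
    (forall x, `|h x| <= `|complex.Im (0 +i* y)|^-1) ->
    `|\int[rho]_x (p.[x] * h x)| <= y^-1 * \int[rho]_x `|p.[x]|.
  move=> ih hb; apply: le_trans (le_normr_Rintegral measurableT ih) _.
  rewrite -integralRZ //; apply: le_Rintegral => //.
  - exact: (integrable_norm ih).
  - exact: (integrableRZ y^-1 ia).
  - move=> x _; rewrite normrM mulrC ler_wpM2r //.
    by have := hb x; rewrite /= (gtr0_norm y0).
split; apply: bnd; try exact: integrableR_kernel_re; try exact: integrableR_kernel_im.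
- by move=> x; exact: kernel_re_le.
- by move=> x; exact: kernel_im_le.
Qed.

End Measure.

Local Notation toC := (map_poly (real_complex _)).

(** * Moment functional and transforms of orthogonal polynomials *)

Section AllMoments.
Variables (R : realType) (rho : {measure set (measurableTypeR R) -> \bar R}).
Implicit Types (f g : R -> R) (p q : {poly R}) (z : R[i]).

Lemma integrableR_pow k : (\int[rho]_x (`|x| ^+ k)%:E < +oo)%E -> integrableR rho (fun
  x => x ^+ k).
Proof.
move=> h; apply/integrableP; split.
  apply/measurable_EFinP; apply: measurable_funX; exact: measurable_id.
by under eq_integral do rewrite /= normrX.
Qed.

Lemma integrableR_horner p :
  (forall k, (k < size p)%N -> integrableR rho (fun x => x ^+ k)) -> integrableR rho
    (horner p).
Proof.
move=> ip; have -> : horner p = fun x => \sum_(i < size p) p`_i * x ^+ i.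
  by apply/funext => x; rewrite horner_coef.
have : forall n, (n <= size p)%N -> integrableR rho (fun x => \sum_(i < n) p`_i * x ^+ i).
  elim=> [_|n IH lt].
    under eq_fun do rewrite big_ord0; exact: (integrable0 rho).
  under eq_fun do rewrite big_ord_recr /=.
  by apply: integrableRD; [apply: IH; exact: ltnW|apply: integrableRZ; exact: ip].
exact.
Qed.

Hypothesis am : all_moments_exist rho.

Lemma integrableR_poly p : integrableR rho (horner p).
Proof. by apply: integrableR_horner => k _; apply: integrableR_pow; exact: am. Qed.

Lemma moment_functional : exists L : {scalar {poly R}},
  forall p, L p = \int[rho]_x p.[x].
Proof.
pose f (p : {poly R}) : R := \int[rho]_x p.[x].
have lin : scalar f.
  move=> c p q; rewrite /f -integralRZ ?integrableR_poly // -integralRD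
    ?integrableR_poly //.
    by apply: eq_Rintegral => x _; rewrite hornerD hornerZ.
  by apply: integrableRZ; exact: integrableR_poly.
pose L : {scalar {poly R}} := HB.pack f (GRing.isLinear.Build R {poly R} R *%R f lin).
by exists L.
Qed.

Variable L : {scalar {poly R}}.
Hypothesis LE : forall p, L p = \int[rho]_x p.[x].
Local Notation S := (stieltjes rho).

Lemma moments_stieltjesD p q z : nonreal z -> S (p + q) z = S p z + S q z.
Proof. by move=> z0; rewrite stieltjesD //; exact: integrableR_poly. Qed.
Lemma moments_stieltjesZ c p z : nonreal z -> S (c *: p) z = c%:C * S p z.
Proof. by move=> z0; rewrite stieltjesZ //; exact: integrableR_poly. Qed.
Lemma moments_stieltjesMX p z : nonreal z -> S ('X * p) z = z * S p z + (L p)%:C.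
Proof. by move=> z0; rewrite LE stieltjesMX //; exact: integrableR_poly. Qed.
Lemma moments_stieltjes0 z : nonreal z -> S 0 z = 0.
Proof. by move=> z0; rewrite -[0](scale0r (1 : {poly R})) moments_stieltjesZ // mul0r. Qed.

(** [T] is the polynomial of the second kind: its value at [z] is the integral of
    [(p x - p z) / (x - z)]. *)
Lemma stieltjes_affine p : exists T : {poly R}, forall z, nonreal z ->
  S p z = (toC p).[z] * S 1 z + (toC T).[z].
Proof.
elim/poly_ind: p => [|p c [T IH]].
  by exists 0 => z z0; rewrite moments_stieltjes0 // rmorph0 !horner0 mul0r addr0.
exists ('X * T + (L p)%:P) => z z0; rewrite moments_stieltjesD // mulrC
  moments_stieltjesMX // IH //.
rewrite -[c%:P]mulr1 mul_polyC moments_stieltjesZ // !rmorphD !rmorphM /= !map_polyX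
  !map_polyC /=.
by rewrite -mul_polyC mulr1 !map_polyC !hornerE /=; ring.
Qed.

Lemma moments_stieltjes_sum n (f : 'I_n -> {poly R}) z : nonreal z ->
  S (\sum_(i < n) f i) z = \sum_(i < n) S (f i) z.
Proof.
move=> z0; elim: n f => [|n IH] f; first by rewrite !big_ord0 moments_stieltjes0.
by rewrite !big_ord_recr /= moments_stieltjesD // IH.
Qed.

Lemma stieltjes_orthXn k p i z : nonreal z -> orth L k p -> (i <= k)%N ->
  S (p * 'X^i) z = z ^+ i * S p z.
Proof.
move=> z0 op; elim: i => [|i IH] ik; first by rewrite expr0 mulr1 mul1r.
rewrite exprS mulrCA moments_stieltjesMX // IH ?op ?(ltnW ik) // addr0 exprS mulrA.
by [].
Qed.

(** Passing from [p * 'X^i] to [p * 'X^(i.+1)] adds [L (p * 'X^i)], which vanishes for [i < k]; only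
    the coefficient of ['X^(k.+1)] in [q] leaves a remainder. *)
Lemma stieltjes_orthM_lead k p q z : nonreal z -> orth L k p -> (size q <= k.+2)%N ->
  S (p * q) z = (toC q).[z] * S p z + (q`_k.+1 * L (p * 'X^k))%:C.
Proof.
move=> z0 op sq.
have -> : p * q = \sum_(i < k.+2) q`_i *: (p * 'X^i).
  rewrite -{1}(coefK q) poly_def mulr_sumr.
  rewrite (big_ord_widen k.+2 (fun i => p * (q`_i *: 'X^i))) // big_mkcond /=.
  apply: eq_bigr => i _; case: ltnP => [_|leqi]; first by rewrite -scalerAr.
  by rewrite nth_default // scale0r.
rewrite moments_stieltjes_sum // (horner_coef_wide z (n := k.+2)) ?(leq_trans
  (size_poly _ _)) //.
rewrite big_ord_recr [in RHS]big_ord_recr /= mulrDl -addrA; congr (_ + _).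
  rewrite mulr_suml; apply: eq_bigr => i _.
  by rewrite moments_stieltjesZ // (stieltjes_orthXn z0 op (ltnSE (ltn_ord i)))
    coef_map /= mulrA.
rewrite moments_stieltjesZ // exprS mulrCA moments_stieltjesMX // (stieltjes_orthXn z0
  op) // coef_map /= rmorphM /=.
by rewrite exprS; ring.
Qed.

Lemma stieltjes_orthM k p q z : nonreal z -> orth L k p -> (size q <= k.+1)%N ->
  S (p * q) z = (toC q).[z] * S p z.
Proof.
move=> z0 op sq; rewrite (stieltjes_orthM_lead z0 op) ?(leq_trans sq) //.
by rewrite nth_default // mul0r addr0.
Qed.

Lemma ae_sub (P Q : R -> Prop) : (forall x, P x -> Q x) ->
  (\forall x \ae rho, P x) -> \forall x \ae rho, Q x.
Proof. by move=> PQ; apply: negligibleS => x; apply: contra_not; apply: PQ. Qed.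

Lemma integralR_eq0_ae f : integrableR rho f -> (forall x, 0 <= f x) -> \int[rho]_x f x
  = 0 ->
  \forall x \ae rho, f x = 0.
Proof.
move=> fi f0 int0; have mf := measurable_int _ fi.
have /(ae_eq_integral_abs rho measurableT mf) : (\int[rho]_x `|(EFin \o f) x| = 0)%E.
  have -> : (\int[rho]_x `|(EFin \o f) x| = \int[rho]_x (EFin \o f) x)%E.
    by apply: eq_integral => x _; rewrite /= ger0_norm.
  by rewrite -(fineK (integrable_fin_num measurableT fi)); congr EFin.
by apply: ae_sub => x /(_ Logic.I) [].
Qed.

Lemma integralR_ae0 f : measurable_fun setT f -> (\forall x \ae rho, f x = 0) ->
  \int[rho]_x f x = 0.
Proof.
move=> mf f0; rewrite /Rintegral (ae_eq_integral (cst 0%E)) ?integral0 //.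
  exact/measurable_EFinP.
by move: f0; apply: ae_sub => x /= ->.
Qed.

Lemma stieltjes_ae0 p z : nonreal z -> (\forall x \ae rho, p.[x] = 0) -> S p z = 0.
Proof.
move=> z0 p0; rewrite /stieltjes !integralR_ae0 //.
- by apply: measurable_funM; [exact: measurable_horner|exact: measurable_kernel_im].
- by move: p0; apply: ae_sub => x ->; rewrite mul0r.
- by apply: measurable_funM; [exact: measurable_horner|exact: measurable_kernel_re].
- by move: p0; apply: ae_sub => x ->; rewrite mul0r.
Qed.

(* A polynomial vanishing almost everywhere may be replaced by the product over
   its real roots, which has no zero off the real line. *)
Lemma stieltjes1_rational p : p != 0 -> (\forall x \ae rho, p.[x] = 0) ->
  exists P T : {poly R}, forall z, nonreal z ->
    (toC P).[z] != 0 /\ S 1 z = - ((toC T).[z] / (toC P).[z]).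
Proof.
move=> p0 pae; pose P := \prod_(r <- rootsR p) ('X - r%:P).
have Pae : \forall x \ae rho, P.[x] = 0.
  move: pae; apply: ae_sub => x px; apply/rootP.
  by rewrite root_prod_XsubC -(roots_on_rootsR p0) /= /root px eqxx.
have [T TE] := stieltjes_affine P; exists P, T => z z0.
have Pz : (toC P).[z] != 0.
  rewrite /P rmorph_prod horner_prod prodf_seq_neq0; apply/allP => r _ /=.
  rewrite rmorphB /= map_polyX map_polyC !hornerE /= subr_eq0.
  by apply: contraNneq z0 => ->.
split=> //; have := TE z z0; rewrite (stieltjes_ae0 z0 Pae) => e.
apply: (mulfI Pz); rewrite mulrN mulrCA divff // mulr1.
by apply/eqP; rewrite -subr_eq0 opprK -e.
Qed.

(** * Positivity for measures of infinite support *)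

Section Positivity.
Hypothesis inf_supp : forall p, (\forall x \ae rho, p.[x] = 0) -> p = 0.

Lemma integralR_sum_sqr_gt0 p q (h : R -> R) : (p != 0) || (q != 0) ->
  (forall x, 0 < h x) -> integrableR rho (fun x => (p * p + q * q).[x] * h x) ->
  0 < \int[rho]_x ((p * p + q * q).[x] * h x).
Proof.
move=> pq h0 ih.
have V0 x : (p * p + q * q).[x] = p.[x] ^+ 2 + q.[x] ^+ 2.
  by rewrite hornerD !hornerM !expr2.
have pos x : 0 <= (p * p + q * q).[x] * h x.
  by rewrite mulr_ge0 ?(ltW (h0 x)) // V0 addr_ge0 ?sqr_ge0.
rewrite lt_def; apply/andP; split; last exact: Rintegral_ge0.
apply: contraTneq pq => int0.
have ae0 := integralR_eq0_ae ih pos int0.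
rewrite negb_or !negbK; apply/andP; split; apply/eqP/inf_supp;
  apply: ae_sub ae0 => x /eqP; rewrite mulf_eq0 (gt_eqF (h0 x)) orbF V0;
  by rewrite paddr_eq0 ?sqr_ge0 // !sqrf_eq0 => /andP[/eqP ? /eqP ?].
Qed.

Lemma moment_posdef : positive_definite L.
Proof.
move=> p p0; have E : (fun x => (p * p).[x]) = (fun x => (p * p + 0 * 0).[x] * 1).
  by apply/funext => x; rewrite mulr0 addr0 mulr1.
rewrite LE E; apply: integralR_sum_sqr_gt0 => //; first by rewrite p0.
by rewrite -E; exact: integrableR_poly.
Qed.

(* For [D x = S C z * A x - S A z * C x], the orthogonality relations turn the
   Stieltjes transform of [|D|^2] into [conj (S C z) * S A z] plus a real number,
   and its imaginary part is a positive multiple of an integral of [|D|^2]; the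
   polynomial [D] does not vanish because it takes the value 1 at [z]. *)
Lemma wronskian_Im_gt0 k (C A : {poly R}) z : 0 < complex.Im z ->
  (size C <= k.+1)%N -> (size A <= k.+2)%N -> orth L k C -> orth L k A ->
  A`_k.+1 * L (C * 'X^k) = -1 ->
  0 < complex.Im ((S C z)^*%C * S A z).
Proof.
move=> y0 sC sA oC oA lead.
have z0 : nonreal z by rewrite /nonreal gt_eqF.
have SCC := stieltjes_orthM z0 oC sC; have SAC := stieltjes_orthM z0 oA sC.
have SCA := stieltjes_orthM_lead z0 oC sA; have SAA := stieltjes_orthM_lead z0 oA sA.
rewrite lead in SCA; rewrite mulrC SAC in SCA.
set c := A`_k.+1 * _ in SAA.
set e := S C z in SCC SCA *; set f := S A z in SAC SCA SAA *.
set Az := (toC A).[z] in SCA SAA; set Cz := (toC C).[z] in SCC SAC SCA.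
have rel : Az * e = Cz * f + 1 by rewrite SCA rmorphN1 addrNK.
(* [P] and [Q] are the real and imaginary parts of [D] on the real line, so [V] is [|D|^2] there. *)
pose P := complex.Re e *: A - complex.Re f *: C.
pose Q := complex.Im e *: A - complex.Im f *: C.
have PQ : (P != 0) || (Q != 0).
  apply: contraT; rewrite negb_or !negbK => /andP[/eqP P0 /eqP Q0].
  have : (toC P).[z] + 'i%C * (toC Q).[z] = 1.
    rewrite /P /Q !rmorphB /= !map_polyZ /= !hornerE /= -/Az -/Cz.
    have := rel; rewrite [e]complexE [f]complexE => r.
    transitivity (Az * ((complex.Re e)%:C + 'i%C * (complex.Im e)%:C) -
      Cz * ((complex.Re f)%:C + 'i%C * (complex.Im f)%:C)); first by ring.
    by rewrite r addrC addKr.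
  by rewrite P0 Q0 !rmorph0 !horner0 mulr0 addr0 => /esym/eqP; rewrite oner_eq0.
pose V := P * P + Q * Q.
pose s := complex.Re e * complex.Re f + complex.Im e * complex.Im f.
have SV : S V z = e^*%C * f + (complex.Re e ^+ 2 + complex.Im e ^+ 2)%:C * c%:C.
  have -> : V = (complex.Re e ^+ 2 + complex.Im e ^+ 2) *: (A * A) +
     (complex.Re f ^+ 2 + complex.Im f ^+ 2) *: (C * C) +
     (- (s + s)) *: (A * C).
    by rewrite /V /P /Q /s -!mul_polyC !(polyCN, polyCD, polyC_exp, polyCM); ring.
  rewrite !moments_stieltjesD // !moments_stieltjesZ // SAA SCC SAC.
  have nrm (x : R[i]) : (complex.Re x ^+ 2 + complex.Im x ^+ 2)%:C = x * x^*%C.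
    by case: x => x1 x2; simpc; apply/eqP; rewrite eq_complex /=; apply/andP; split;
      apply/eqP; ring.
  have crs : (- (s + s))%:C =
      - (e * f^*%C + e^*%C * f).
    rewrite /s; case: (e) (f) => e1 e2 [f1 f2]; simpc.
    by apply/eqP; rewrite eq_complex /=; apply/andP; split; apply/eqP; ring.
  rewrite !nrm crs.
  transitivity (e^*%C * f * (Az * e - Cz * f) + e * e^*%C * c%:C); first by ring.
  by rewrite rel; ring.
have -> : e^*%C * f = S V z - (complex.Re e ^+ 2 + complex.Im e ^+ 2)%:C * c%:C.
  by rewrite SV addrK.
rewrite -rmorphM raddfB /= subr0; apply: integralR_sum_sqr_gt0 => //.
  by move=> x; rewrite /kernel_im divr_gt0 // kernel_den_gt0.
by apply: integrableR_kernel_im z0 _; exact: integrableR_poly.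
Qed.

End Positivity.
End AllMoments.

(** * From moments to the expansion *)

Section Derivable.
Variable R : realType.
Implicit Types (f g : R[i] -> R[i]) (z : R[i]).

Definition cderivable f z := derivable (f : R[i]^o -> R[i]^o) z 1.

Lemma cderivable_cst (c : R[i]) z : cderivable (fun=> c) z.
Proof. exact: derivable_cst. Qed.

Lemma cderivable_id z : cderivable id z.
Proof. exact: derivable_id. Qed.

Lemma cderivableD f g z : cderivable f z -> cderivable g z ->
  cderivable (fun x => f x + g x) z.
Proof. by move=> df dg; exact: (derivableD df dg). Qed.

Lemma cderivableM f g z : cderivable f z -> cderivable g z ->
  cderivable (fun x => f x * g x) z.
Proof. by move=> df dg; exact: (derivableM df dg). Qed.

Lemma cderivableN f z : cderivable f z -> cderivable (fun x => - f x) z.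
Proof. by move=> df; exact: (derivableN df). Qed.

Lemma cderivableV f z : f z != 0 -> cderivable f z -> cderivable (fun x => (f x)^-1) z.
Proof. by move=> f0 df; exact: (derivableV f0 df). Qed.

Lemma cderivable_horner (p : {poly R[i]}) z : cderivable (horner p) z.
Proof.
elim/poly_ind: p => [|p c IH].
  have -> : horner (0 : {poly R[i]}) = fun=> 0 by apply/funext => x; rewrite horner0.
  exact: cderivable_cst.
have -> : horner (p * 'X + c%:P) = fun x => p.[x] * x + c.
  by apply/funext => x; rewrite !hornerE.
have did : cderivable id z by exact: cderivable_id.
have dc : cderivable (fun=> c) z by exact: cderivable_cst.
exact: (cderivableD (cderivableM IH did) dc).
Qed.

End Derivable.

Section Representation.
Variables (R : realType) (m : R[i] -> R[i]) (a b : R).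
Variable rho : {measure set (measurableTypeR R) -> \bar R}.
Hypothesis m_repr : integral_representation a b rho m.
Implicit Type z : R[i].

(** The subtracted term of the integrand is real and drops out, so this identity is available before
    [rho] is known to be finite. *)
Lemma repr_Im z : nonreal z ->
  complex.Im (m z) = b * complex.Im z + \int[rho]_x kernel_im z x.
Proof.
move=> z0; case: m_repr => _ _ -> //; case: z z0 => x y z0; rewrite /cRintegral.
rewrite !raddfD /=; simpc; congr (_ + _).
apply: eq_Rintegral => t _; rewrite /kernel_im /kernel_den /=.
by rewrite mulNr opprK addr0 sqrrN.
Qed.

Let s1 := moment a b rho (- 1).

(** For finite [rho] the term [x / (1 + x^2)], the real part of the kernel at the imaginary unit,
    can be integrated on its own. *)
Lemma repr_stieltjes z : integrableR rho (horner 1) -> nonreal z ->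
  m z = b%:C * z + (- s1)%:C + stieltjes rho 1 z.
Proof.
move=> i1 z0; have i0 : nonreal (0 +i* 1 : R[i]) by rewrite /nonreal /= oner_eq0.
have E x : (1 : {poly R}).[x] * kernel_re (0 +i* 1) x = x / (1 + x ^+ 2).
  by rewrite hornerC mul1r /kernel_re /kernel_den /= subr0 expr1n addrC.
have ir := integrableR_kernel_re i0 i1; have kr := integrableR_kernel_re z0 i1.
case: m_repr => _ _ -> //; rewrite [a%:C + _]addrC -!addrA; congr (_ + _).
have -> : cRintegral rho (fun x => (x%:C - z)^-1 - (x / (1 + x ^+ 2))%:C) =
    stieltjes rho 1 z - (\int[rho]_x (x / (1 + x ^+ 2)))%:C.
  rewrite /cRintegral /stieltjes; simpc; congr (_ +i* _).
    transitivity (\int[rho]_x ((1 : {poly R}).[x] * kernel_re z x +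
        (-1) * ((1 : {poly R}).[x] * kernel_re (0 +i* 1) x))).
      apply: eq_Rintegral => x _; rewrite kernelE E hornerC mul1r mulN1r.
      by [].
    rewrite (integralRD kr (integrableRZ (-1) ir)) (integralRZ (-1) ir) mulN1r; congr
      (_ - _).
    by apply: eq_Rintegral => x _; rewrite E.
  by apply: eq_Rintegral => x _; rewrite kernelE hornerC mul1r /= subr0.
by rewrite /s1 /= opprB rmorphB /=; ring.
Qed.

End Representation.

Section Existence.
Variables (R : realType) (m : R[i] -> R[i]) (a b : R).
Variable rho : {measure set (measurableTypeR R) -> \bar R}.
Hypothesis m_herglotz : herglotz m.
Hypothesis m_nonrational : ~ rational_function m.
Hypothesis m_repr : integral_representation a b rho m.
Hypothesis am : all_moments_exist rho.
Implicit Type z : R[i].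

Let s1 := moment a b rho (- 1).
Local Notation S := (stieltjes rho).

Lemma stieltjes1_repr z : nonreal z -> S 1 z = m z - b%:C * z + s1%:C.
Proof.
move=> z0; rewrite (repr_stieltjes m_repr (integrableR_poly am 1) z0) -/s1 rmorphN /=.
by ring.
Qed.

(** Otherwise the transform of 1 would be rational off the real line, and with it [m]. *)
Lemma infinite_support (p : {poly R}) : (\forall x \ae rho, p.[x] = 0) -> p = 0.
Proof.
have [L LE] := moment_functional am.
move=> pae; apply/eqP/negPn/negP => p0; apply: m_nonrational.
have [P [T PT]] := stieltjes1_rational am LE p0 pae.
exists (((toC P) * (b%:C%:P * 'X - s1%:C%:P)) - toC T), (toC P) => z z0.
have [Pz S1z] := PT z z0; split=> //.
have := stieltjes1_repr z0; rewrite S1z => e.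
have -> : m z = b%:C * z - s1%:C - (toC T).[z] / (toC P).[z] by rewrite -addrA e; ring.
by rewrite !hornerE; field.
Qed.

Lemma cfrac_iterate (u w l : nat -> R) (X : nat -> R[i]) z :
  (forall n, X n = (u n)%:C * z + (w n)%:C + 1 / (- (l n.+1)%:C * z + 1 / X n.+1)) ->
  forall N n, X n = cfrac u w l n N (X (n + N)%N) z.
Proof.
move=> step; elim=> [|N IH] n /=; first by rewrite addn0.
by rewrite addnS -addSn -IH -step.
Qed.

(** Here [e], [d], [x] will be the transforms of [C n.+1], ['X * Rr n.+1], ['X * Rr n], and the
    hypothesis on [d] is the transformed recursion of [Rr]. *)
Lemma cfrac_block (F : fieldType) (l z e d x : F) :
  e != 0 -> d != 0 -> x != 0 -> d = - l * z * e + x ->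
  1 / (- l * z + 1 / (- e / d)) = - e / x.
Proof.
move=> e0 d0 x0 dE; have -> : 1 / (- e / d) = - (d / e) by rewrite div1r invf_div invrN
  mulrN.
have -> : - l * z + - (d / e) = - (x / e) by rewrite dE; field.
by rewrite div1r invrN invf_div mulNr.
Qed.

Lemma cfrac_exists : exists (mt : nat -> R[i] -> R[i]) (u w l : nat -> R),
  cfrac_expansion m mt u w l.
Proof.
have [L LE] := moment_functional am.
have pd := moment_posdef am LE infinite_support.
have [C [Rr [u [w [l [k [ch u0]]]]]]] := chain_exists pd.
pose A n := 'X * Rr n.
have /choice[T TE] := stieltjes_affine am LE.
have SE p z : nonreal z ->
    S p z = (toC p).[z] * (m z - b%:C * z + s1%:C) + (toC (T p)).[z].
  by move=> z0; rewrite TE // stieltjes1_repr.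
have wr n z : 0 < complex.Im z -> 0 < complex.Im ((S (C n) z)^*%C * S (A n) z).
  move=> y0; apply: (wronskian_Im_gt0 am LE infinite_support (k := k n)) => //.
  - by rewrite (chain_sizeC ch).
  - by rewrite (chain_sizeA ch).
  - exact: (chain_orthC ch).
  - exact: (chain_orthA_low ch).
  rewrite coefXM /= -(chain_pairing ch n) (orthM_lead (chain_orthC ch (n := n))) //.
  by rewrite (chain_sizeR ch).
have nz n z : nonreal z -> S (C n) z != 0 /\ S (A n) z != 0.
  have up z' : 0 < complex.Im z' -> S (C n) z' != 0 /\ S (A n) z' != 0.
    move=> y0; have W := wr n z' y0; split; apply: contraTneq W => ->.
      by rewrite conjc0 mul0r ltxx.
    by rewrite mulr0 ltxx.
  move=> z0; case: (ltgtP 0 (complex.Im z)) => [|y0|/esym y0]; first exact: up.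
    have := up z^*%C; case: (z) z0 y0 => x y z0 y0 /(_ _)[]; first by rewrite /= oppr_gt0.
    by rewrite !(stieltjes_conj z0 (integrableR_poly am _)) !conjc_eq0.
  by move: z0; rewrite /nonreal y0 eqxx.
(* Off the real line [F p] equals [S p]; written with [m], it inherits differentiability from [m]
   without differentiation under the integral sign. *)
pose F p z := (toC p).[z] * (m z - b%:C * z + s1%:C) + (toC (T p)).[z].
pose mt n z := - F (C n.-1) z / F (A n.-1) z.
have FE p z : nonreal z -> F p z = S p z by move=> z0; rewrite SE.
have dF p z : nonreal z -> cderivable (F p) z.
  move=> z0; have [dm _ _] := m_herglotz.
  apply: cderivableD; last exact: cderivable_horner.
  apply: cderivableM; first exact: cderivable_horner.
  apply: cderivableD; last exact: cderivable_cst.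
  apply: (cderivableD (f := m)); first exact: dm.
  apply: (cderivableN (f := fun x => b%:C * x)).
  by apply: cderivableM; [exact: cderivable_cst|exact: cderivable_id].
pose u' n := if n is n'.+1 then u n'.+1 else b.
pose w' n := if n is n'.+1 then w n'.+1 else - s1.
exists mt, u', w', l; split.
- move=> n n1; split.
  + move=> z z0; have [_ A0] := nz n.-1 z z0.
    apply: (cderivableM (f := fun x => - F (C n.-1) x)).
      by apply: cderivableN; exact: dF.
    by apply: cderivableV; [rewrite FE|exact: dF].
  + move=> z y0; have z0 : nonreal z by rewrite /nonreal gt_eqF.
    rewrite /mt !FE //; have [_ A0] := nz n.-1 z z0.
    have := wr n.-1 z y0; move: A0; case: (S (A n.-1) z) (S (C n.-1) z) => f1 f2 [e1 e2].
    rewrite eq_complex /= => f0; simpc => lt0.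
    have d0 : 0 < f1 ^+ 2 + f2 ^+ 2.
      rewrite lt_def addr_ge0 ?sqr_ge0 // andbT paddr_eq0 ?sqr_ge0 //.
      by rewrite !sqrf_eq0.
    have -> : e1 * (f2 / (f1 ^+ 2 + f2 ^+ 2)) - e2 * (f1 / (f1 ^+ 2 + f2 ^+ 2)) =
      (e1 * f2 - e2 * f1) / (f1 ^+ 2 + f2 ^+ 2) by ring.
    by rewrite divr_ge0 ?(ltW d0) // ltW.
  + move=> z z0; have z0' : nonreal z^*%C.
      by move: z0; case: (z) => x y; rewrite /nonreal /= oppr_eq0.
    rewrite /mt !FE // !(stieltjes_conj z0 (integrableR_poly am _)).
    by rewrite rmorphM rmorphN fmorphV.
- case=> [|n] /=; last exact: u0.
  by case: m_repr.
- by case=> // n _; exact: (chain_l ch).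
- case=> // n _ /=; have := chain_uw ch n; have := u0 n.
  rewrite le_eqVlt => /predU1P[<-|lt _]; last by rewrite ltr_pwDl.
  by rewrite eqxx /= add0r normr_gt0.
- move=> N z; case: N => // N _ z0.
  pose X n := if n is n'.+1 then mt n z else m z.
  suff step n : X n = (u' n)%:C * z + (w' n)%:C + 1 / (- (l n.+1)%:C * z + 1 / X n.+1).
    by have := cfrac_iterate step N.+1 0; rewrite add0n.
  have zC j := (nz j z z0).1; have zA j := (nz j z z0).2.
  have mtE j : mt j.+1 z = - S (C j) z / S (A j) z by rewrite /mt !FE.
  case: n => [|j]; rewrite /X !mtE /=.
    have := zC 0%N; have := zA 0%N; rewrite (chain_C0 ch) /A (chain_R0 ch).
    rewrite -[(_)%:P]mulr1 mul_polyC -scalerAr (moments_stieltjesZ am) //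
      (moments_stieltjesMX am LE) //.
    have L1 : l 1%N * L 1 = 1.
      by have := chain_normC ch 0; rewrite (chain_C0 ch) mulr1.
    have {}L1 : (l 1%N)%:C * (L 1)%:C = 1 by rewrite -rmorphM L1.
    rewrite rmorphN /= => nA nS; have := stieltjes1_repr z0 => e.
    have -> : m z = b%:C * z + - s1%:C + S 1 z by rewrite e; ring.
    (* In the first block the constant -1, which is [L (Rr 0)], takes the place of the transform of
       a preceding denominator. *)
    rewrite rmorphN /=; congr (_ + _); rewrite (cfrac_block (x := -1)) ?oppr_eq0
      ?oner_eq0 //.
      by rewrite invrN invr1 mulrN1 opprK.
    by rewrite mulrDr mulrA; congr (_ + _); rewrite mulNr L1.
  have SC : S (C j.+1) z = ((u j.+1)%:C * z + (w j.+1)%:C) * S (A j) z + S (C j) z.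
    have -> : C j.+1 = u j.+1 *: ('X * A j) + w j.+1 *: A j + C j.
      by rewrite (chain_CS ch) -/(A j) -!mul_polyC; ring.
    rewrite !(moments_stieltjesD am) // !(moments_stieltjesZ am) //
      (moments_stieltjesMX am LE) //.
    have uL : (u j.+1)%:C * (L (A j))%:C = 0.
      have [->|uj] := eqVneq (u j.+1) 0; first by rewrite mul0r.
      rewrite (orth1 _ (chain_orthA ch (n := j))) ?mulr0 //.
      by rewrite (chain_kS ch) uj addn1.
    by rewrite mulrDr uL addr0 mulrDl mulrA.
  have SA : S (A j.+1) z = - (l j.+2)%:C * z * S (C j.+1) z + S (A j) z.
    have -> : A j.+1 = - l j.+2 *: ('X * C j.+1) + A j.
      by rewrite /A (chain_RS ch) -!mul_polyC; ring.
    rewrite (moments_stieltjesD am) // (moments_stieltjesZ am) // (moments_stieltjesMX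
      am LE) //.
    rewrite (orth1 _ (chain_orthC ch (n := j.+1))) ?(chain_k_gt0 ch) //.
    by rewrite addr0 rmorphN mulrA.
  rewrite (cfrac_block (zC j.+1) (zA j.+1) (zA j) SA) SC.
  by have := zA j => n3; field.
Qed.

End Existence.

Local Notation modulus := Normc.normc.

(** * Decay along the imaginary axis *)

Section Modulus.
Variable R : realType.
Implicit Types (z : R[i]) (x y : R).

Lemma modulus_ge0 z : 0 <= modulus z. Proof. by case: z => a b; exact: sqrtr_ge0. Qed.

Lemma modulus_sqr z : modulus z ^+ 2 = complex.Re z ^+ 2 + complex.Im z ^+ 2.
Proof. by case: z => a b; rewrite sqr_sqrtr // addr_ge0 ?sqr_ge0. Qed.

Lemma modulus_eq0 z : (modulus z == 0) = (z == 0).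
Proof.
by apply/eqP/eqP => [/Normc.eq0_normc|->]//; exact: Normc.normc0.
Qed.

Lemma modulus_gt0 z : (0 < modulus z) = (z != 0).
Proof. by rewrite lt_def modulus_eq0 modulus_ge0 andbT. Qed.

Lemma modulus_real x : modulus x%:C = `|x|.
Proof. by rewrite /= expr0n addr0 sqrtr_sqr. Qed.

Lemma modulus_Re z : `|complex.Re z| <= modulus z.
Proof.
rewrite -(ler_pXn2r (n := 2)) ?nnegrE ?modulus_ge0 // modulus_sqr real_normK ?num_real //.
by rewrite lerDl sqr_ge0.
Qed.

Lemma modulus_Im z : `|complex.Im z| <= modulus z.
Proof.
rewrite -(ler_pXn2r (n := 2)) ?nnegrE ?modulus_ge0 // modulus_sqr real_normK ?num_real //.
by rewrite lerDr sqr_ge0.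
Qed.

Lemma modulus_le z : modulus z <= `|complex.Re z| + `|complex.Im z|.
Proof.
rewrite -(ler_pXn2r (n := 2)) ?nnegrE ?modulus_ge0 ?addr_ge0 // modulus_sqr.
rewrite -[in leLHS](real_normK (num_real (complex.Re z))).
rewrite -[in leLHS](real_normK (num_real (complex.Im z))).
have := normr_ge0 (complex.Re z); have := normr_ge0 (complex.Im z); nra.
Qed.

Lemma modulus_iy y : 0 < y -> modulus (0 +i* y) = y.
Proof. by move=> y0; rewrite /= expr0n add0r sqrtr_sqr gtr0_norm. Qed.

Lemma modulus_lower z z' : modulus z - modulus z' <= modulus (z + z').
Proof.
have := le_normcD (z + z') (- z'); rewrite addrK normcN; lra.
Qed.

End Modulus.

Section Decay.
Variable R : realType.
Implicit Types (f g : R[i] -> R[i]) (p q T : {poly R}) (y : R).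

(** The bound [O(y^-d)] at [i y] for large [y]; [1 <= y0] makes powers of [y] monotone in the
    exponent. *)
Definition decays d f := exists K y0 : R, 1 <= y0 /\
  forall y, y0 <= y -> modulus (f (0 +i* y)) * y ^+ d <= K.

Lemma decays_leq d d' f : (d' <= d)%N -> decays d f -> decays d' f.
Proof.
move=> dd [K [y0 [y01 H]]]; exists K, y0; split=> // y yy0.
apply: le_trans (H y yy0); rewrite ler_wpM2l ?modulus_ge0 // ler_weXn2l //.
exact: le_trans yy0.
Qed.

Lemma decaysD d f g : decays d f -> decays d g -> decays d (fun z => f z + g z).
Proof.
move=> [K [y0 [y01 H]]] [K' [y0' [y01' H']]].
exists (K + K'), (Num.max y0 y0'); split; first by rewrite le_max y01.
move=> y; rewrite ge_max => /andP[h h'].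
apply: le_trans (lerD (H y h) (H' y h')); rewrite -mulrDl ler_wpM2r //.
  by rewrite exprn_ge0 // (le_trans _ h) // (le_trans _ y01).
exact: le_normcD.
Qed.

Lemma decaysN d f : decays d f -> decays d (fun z => - f z).
Proof.
by move=> [K [y0 [y01 H]]]; exists K, y0; split=> // y /H; rewrite normcN.
Qed.

Lemma decaysMX d f : decays d.+1 f -> decays d (fun z => z * f z).
Proof.
move=> [K [y0 [y01 H]]]; exists K, y0; split=> // y yy0.
have y0' : 0 < y by rewrite (lt_le_trans _ yy0) // (lt_le_trans _ y01).
by apply: le_trans (H y yy0); rewrite Normc.normcM modulus_iy // exprS mulrCA mulrA.
Qed.

Lemma decays_eq d f g : (forall y, 0 < y -> f (0 +i* y) = g (0 +i* y)) ->
  decays d f -> decays d g.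
Proof.
move=> fg [K [y0 [y01 H]]]; exists K, y0; split=> // y yy0.
by rewrite -fg ?H // (lt_le_trans _ yy0) // (lt_le_trans _ y01).
Qed.

(** Induction along Horner's scheme: the threshold for [y] makes the added constant at most half of
    the main term, which halves [c]. *)
Lemma poly_lower T : T != 0 -> exists c y0 : R, [/\ 0 < c, 1 <= y0 &
  forall y, y0 <= y -> c * y ^+ (size T).-1 <= modulus (toC T).[0 +i* y]].
Proof.
elim/poly_ind: T => [|p t IH]; first by rewrite eqxx.
have [->|p0] := eqVneq p 0.
  rewrite mul0r add0r polyC_eq0 => t0; exists `|t|, 1; split; rewrite ?normr_gt0 //.
  move=> y _; rewrite size_polyC t0 /= mulr1 map_polyC hornerC.
  by rewrite modulus_real.
move=> _; have [c [y0 [c0 y01 H]]] := IH p0.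
have c2 : 0 < c / 2 by rewrite divr_gt0.
exists (c / 2), (Num.max y0 (`|t| / (c / 2))); split=> //; first by rewrite le_max y01.
move=> y; rewrite ge_max ler_pdivrMr // => /andP[yy0 yt].
have y1 : 1 <= y by exact: le_trans yy0.
have y_0 : 0 < y by exact: lt_le_trans y1.
rewrite size_MXaddC (negbTE p0) /= rmorphD rmorphM /= map_polyX map_polyC !hornerE /=.
apply: le_trans (modulus_lower _ _); rewrite modulus_real Normc.normcM modulus_iy //.
have := H y yy0; set d := (size p).-1 => Hp.
have -> : size p = d.+1 by rewrite prednK // size_poly_gt0.
have yd : 1 <= y ^+ d by rewrite exprn_ege1.
have h1 : c * y ^+ d * y <= modulus (toC p).[0 +i* y] * y by rewrite ler_wpM2r // ltW.
have h2 : `|t| <= c / 2 * (y ^+ d * y).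
  apply: (le_trans yt); rewrite mulrC ler_wpM2l ?(ltW c2) //.
  by rewrite ler_peMl // ltW.
by rewrite exprSr; move: h1 h2; rewrite -!mulrA; set Y := y ^+ d * y; lra.
Qed.

Lemma poly_upper p : exists2 K : R, 0 <= K &
  forall y, 1 <= y -> modulus (toC p).[0 +i* y] <= K * y ^+ (size p).-1.
Proof.
elim/poly_ind: p => [|p t [K K0 IH]].
  by exists 0 => // y _; rewrite rmorph0 horner0 Normc.normc0 mul0r.
exists (K + `|t|); first by rewrite addr_ge0.
move=> y y1; have y_0 : 0 < y by exact: lt_le_trans y1.
rewrite rmorphD rmorphM /= map_polyX map_polyC !hornerE /=.
apply: le_trans (le_normcD _ _) _; rewrite modulus_real Normc.normcM modulus_iy //.
have [->|p0] := eqVneq p 0.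
  rewrite rmorph0 horner0 Normc.normc0 !mul0r !add0r size_polyC.
  by case: (t != 0); rewrite expr0 mulr1 lerDr.
have := IH y y1; set d := (size p).-1 => Hp.
rewrite size_MXaddC (negbTE p0) /=.
have -> : size p = d.+1 by rewrite prednK // size_poly_gt0.
rewrite mulrDl lerD //.
  by rewrite exprSr mulrA ler_wpM2r // ltW.
by rewrite ler_peMr // exprn_ege1.
Qed.

Lemma decays_poly_eq0 T : decays 1 (horner (toC T)) -> T = 0.
Proof.
move=> [K [y0 [y01 H]]]; apply/eqP/negPn/negP => /poly_lower[c [y1 [c0 y11 H1]]].
pose y := y0 + y1 + `|K| / c.
have q0 : 0 <= `|K| / c by rewrite divr_ge0 // ltW.
have yy0 : y0 <= y by rewrite /y -addrA lerDl addr_ge0 // (le_trans _ y11).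
have yy1 : y1 <= y by rewrite /y addrAC lerDr addr_ge0 // (le_trans _ y01).
have y_1 : 1 <= y by exact: le_trans yy0.
have e1 : c <= modulus (toC T).[0 +i* y].
  by apply: le_trans (H1 y yy1); rewrite ler_peMr ?(ltW c0) // exprn_ege1.
have := H y yy0; rewrite expr1 => e2.
have e3 : c * y <= K.
  by apply: le_trans e2; rewrite ler_wpM2r // (le_trans _ y_1).
have : c * y > K.
  rewrite /y !mulrDr [c * (_ / c)]mulrC divfK ?gt_eqF //.
  have : 0 < c * y0 by rewrite mulr_gt0 // (lt_le_trans _ y01).
  have : 0 < c * y1 by rewrite mulr_gt0 // (lt_le_trans _ y11).
  have := ler_norm K; lra.
by rewrite ltNge e3.
Qed.

End Decay.

Section Evaluation.
Variable R : realType.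
Implicit Types (p q : {poly R}) (c : R) (z : R[i]).

Lemma evalD p q z : (toC (p + q)).[z] = (toC p).[z] + (toC q).[z].
Proof. by rewrite rmorphD hornerD. Qed.
Lemma evalN p z : (toC (- p)).[z] = - (toC p).[z].
Proof. by rewrite rmorphN hornerN. Qed.
Lemma evalM p q z : (toC (p * q)).[z] = (toC p).[z] * (toC q).[z].
Proof. by rewrite rmorphM hornerM. Qed.
Lemma evalX z : (toC ('X : {poly R})).[z] = z.
Proof. by rewrite map_polyX hornerX. Qed.
Lemma evalC c z : (toC c%:P).[z] = c%:C.
Proof. by rewrite map_polyC hornerC. Qed.
Lemma evalZ c p z : (toC (c *: p)).[z] = c%:C * (toC p).[z].
Proof. by rewrite -mul_polyC evalM evalC. Qed.

End Evaluation.

(** * Convergents of a given expansion and the decay of their errors *)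

Section Convergents.
Variable R : realType.
Variables (m : R[i] -> R[i]) (mt : nat -> R[i] -> R[i]) (u w l : nat -> R).
Hypothesis cf : cfrac_expansion m mt u w l.
Implicit Type z : R[i].

(** The recursion of [chain] run with the constants of the given expansion; as there, the second
    component omits the factor ['X]. *)
Fixpoint denoms n : {poly R} * {poly R} :=
  if n is n'.+1 then
    let C := ((u n)%:P * 'X + (w n)%:P) * ('X * (denoms n').2) + (denoms n').1 in
    (C, - l n.+1 *: C + (denoms n').2)
  else (1, (- l 1%N)%:P).

Definition denC n := (denoms n).1.
Definition denR n := (denoms n).2.

(* Denominator times [m] minus numerator, for the convergents ending with
   [u_n z + w_n] and with [- l_(n+1) z]. *)
Fixpoint errs n z : R[i] * R[i] :=
  let C := if n is n'.+1
    then ((u n)%:C * z + (w n)%:C) * (errs n' z).2 + (errs n' z).1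
    else m z - (u 0%N)%:C * z - (w 0%N)%:C in
  (C, - (l n.+1)%:C * z * C + (if n is n'.+1 then (errs n' z).2 else - 1)).

Definition errC n z := (errs n z).1.
Definition errA n z := (errs n z).2.

Lemma errCS n z : errC n.+1 z =
  ((u n.+1)%:C * z + (w n.+1)%:C) * errA n z + errC n z.
Proof. by []. Qed.

Lemma errA0 z : errA 0 z = - (l 1%N)%:C * z * errC 0 z - 1.
Proof. by []. Qed.

Lemma errAS n z : errA n.+1 z = - (l n.+2)%:C * z * errC n.+1 z + errA n z.
Proof. by []. Qed.

Lemma errs_affine n : exists P Q : {poly R}, forall z,
  errC n z = (toC (denC n)).[z] * m z - (toC P).[z] /\
  errA n z = (toC ('X * denR n)).[z] * m z - (toC Q).[z].
Proof.
elim: n => [|n [P [Q IH]]].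
  pose P := (u 0%N)%:P * 'X + (w 0%N)%:P.
  exists P, ((- l 1%N)%:P * 'X * P + 1) => z.
  have e1 : (toC (1 : {poly R})).[z] = 1 by rewrite -[1]/(1%:P) evalC.
  rewrite /errC /errA /denC /denR /P /=.
  by rewrite !(evalD, evalM, evalX, evalC, e1) rmorphN; split; ring.
pose P' := ((u n.+1)%:P * 'X + (w n.+1)%:P) * Q + P.
exists P', ((- l n.+2)%:P * 'X * P' + Q) => z.
have [eC eA] := IH z.
have E1 : errC n.+1 z = (toC (denC n.+1)).[z] * m z - (toC P').[z].
  rewrite errCS eC eA /P' /denC /= -/(denC n) -/(denR n).
  by rewrite !(evalD, evalM, evalX, evalC); ring.
split=> //; rewrite errAS E1 eA; set C := denC n.+1 in E1 *.
have -> : denR n.+1 = - l n.+2 *: C + denR n by [].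
by rewrite !(evalD, evalM, evalX, evalC, evalZ) rmorphN; ring.
Qed.

(** In the fraction with [N] blocks, [tail N j] starts with [u_j z + w_j] and [btail N j] with
    [- l_(j+1) z]; [tail N N] is [mt N]. *)
Definition tail N j z := cfrac u w l j (N - j) (mt N z) z.
Definition btail N j z := - (l j.+1)%:C * z + 1 / tail N j.+1 z.

Lemma tail0 N z : (0 < N)%N -> nonreal z -> tail N 0 z = m z.
Proof. by move=> N0 z0; case: cf => _ _ _ _ /(_ N z N0 z0) ->; rewrite /tail subn0. Qed.

Lemma tailS N j z : (j < N)%N -> tail N j z = (u j)%:C * z + (w j)%:C + 1 / btail N j z.
Proof.
move=> jN; rewrite /btail /tail.
have -> : (N - j = (N - j.+1).+1)%N by rewrite subnSK.
by [].
Qed.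

Lemma Im_inv z : complex.Im z^-1 = - complex.Im z / (modulus z ^+ 2).
Proof. by rewrite modulus_sqr; case: z => x y /=; rewrite mulNr. Qed.

(** Downward induction from [mt N]: each inversion exchanges the closed half-planes, also at zero,
    where [0^-1 = 0]. *)
Lemma tail_Im N j z : (j <= N)%N -> 0 < complex.Im z -> (0 < N)%N ->
  0 <= complex.Im (tail N j z).
Proof.
case: cf => Hm u0 l0 uw0 _ jN y0 N0.
move dE: (N - j)%N => d; elim: d j jN dE => [|d IH] j jN dE.
  rewrite /tail dE /=; have [_ + _] := Hm N N0; exact.
have jN' : (j < N)%N by rewrite -subn_gt0 dE.
have := IH j.+1 jN' _; rewrite subnS dE => /(_ erefl) t0.
rewrite tailS // div1r !raddfD /=.
have -> : complex.Im ((u j)%:C * z) = u j * complex.Im z by case: (z) => x y /=; ring.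
rewrite addr0 Im_inv; suff b0 : complex.Im (btail N j z) <= 0.
  by rewrite addr_ge0 ?mulr_ge0 ?invr_ge0 ?oppr_ge0 ?sqr_ge0 ?u0 ?(ltW y0).
rewrite /btail raddfD /= div1r Im_inv.
have -> : complex.Im (- (l j.+1)%:C * z) = - (l j.+1 * complex.Im z).
  by case: (z) => x y /=; ring.
have h1 : 0 <= l j.+1 * complex.Im z by rewrite mulr_ge0 ?(ltW y0) ?ltW // l0.
have h2 : 0 <= complex.Im (tail N j.+1 z) / modulus (tail N j.+1 z) ^+ 2.
  by rewrite divr_ge0 ?sqr_ge0.
by rewrite mulNr; move: h1 h2; lra.
Qed.

Lemma btail_Im N j z : (j < N)%N -> 0 < complex.Im z ->
  l j.+1 * complex.Im z <= - complex.Im (btail N j z).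
Proof.
move=> jN y0; have N0 : (0 < N)%N by apply: leq_ltn_trans jN.
have t0 := tail_Im jN y0 N0.
rewrite /btail raddfD /= div1r Im_inv.
have -> : complex.Im (- (l j.+1)%:C * z) = - (l j.+1 * complex.Im z).
  by case: (z) => x y /=; ring.
by rewrite opprD opprK lerDl mulNr opprK divr_ge0 ?sqr_ge0.
Qed.

Lemma btail_norm N j z : (j < N)%N -> 0 < complex.Im z ->
  0 < l j.+1 * complex.Im z <= modulus (btail N j z).
Proof.
move=> jN y0; case: (cf) => _ _ l0 _ _; rewrite mulr_gt0 ?l0 //=.
apply: (le_trans (btail_Im jN y0)); apply: le_trans (modulus_Im _).
by rewrite -normrN ler_norm.
Qed.

Lemma btail_neq0 N j z : (j < N)%N -> 0 < complex.Im z -> btail N j z != 0.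
Proof.
by move=> jN y0; rewrite -modulus_gt0; have /andP[] := btail_norm jN y0; exact: lt_le_trans.
Qed.

Lemma tail_Im_lower N j z : (j < N)%N -> 0 < complex.Im z ->
  u j * complex.Im z < complex.Im (tail N j z).
Proof.
move=> jN y0; rewrite tailS // div1r !raddfD /= Im_inv addr0.
have -> : complex.Im ((u j)%:C * z) = u j * complex.Im z by case: (z) => x y /=; ring.
case: (cf) => _ _ l0 _ _.
rewrite ltrDl divr_gt0 ?exprn_gt0 ?modulus_gt0 ?btail_neq0 //.
by rewrite (lt_le_trans _ (btail_Im jN y0)) // mulr_gt0 // l0.
Qed.

Lemma tail_neq0 N j z : (j < N)%N -> 0 < complex.Im z -> tail N j z != 0.
Proof.
move=> jN y0; have := tail_Im_lower jN y0; case: (cf) => _ u0 _ _ _.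
apply: contraTneq => ->; rewrite -leNgt mulr_ge0 // ltW //.
Qed.

(** Consecutive errors differ, up to sign, by a tail as factor; for [j = 0] the constant -1 stands
    for the error before [errC 0]. The second relation asks for one more block, which makes its tail
    non-zero. *)
Lemma err_tail N j z : 0 < complex.Im z ->
  ((j < N)%N -> errC j z * btail N j z = - (if j is j'.+1 then errA j' z else -1)) /\
  ((j.+1 < N)%N -> errC j z = - tail N j.+1 z * errA j z).
Proof.
move=> y0; have z0 : nonreal z by rewrite /nonreal gt_eqF.
elim: j => [|j [_ IH]].
- have h : (0 < N)%N -> errC 0 z * btail N 0 z = 1.
    move=> N0; rewrite /errC /= -(tail0 N0 z0) (tailS z N0).
    by field; exact: btail_neq0.
  split; first by move=> /h ->; rewrite opprK.
  move=> N1; have N0 := ltnW N1; have t0 := tail_neq0 N1 y0.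
  rewrite errA0 -(h N0) /btail; set e := errC 0 z; set t := tail N 1 z in t0 *.
  by field.
- have h : (j.+1 < N)%N -> errC j.+1 z * btail N j.+1 z = - errA j z.
    move=> jN; rewrite errCS IH // (tailS z jN).
    by field; exact: btail_neq0.
  split=> // jN; have t0 := tail_neq0 jN y0.
  have := h (ltnW jN); rewrite errAS /btail.
  set e := errC j.+1 z; set t := tail _ _ z in t0 *; set f := errA j z => E.
  have -> : f = - (e * (- (l j.+2)%:C * z + 1 / t)) by rewrite E opprK.
  by field.
Qed.

(** The degrees of the denominators [denC n]. *)
Fixpoint kappa_of n := if n is n'.+1 then (kappa_of n' + (u n != 0%R)).+1 else 0%N.

(** By [err_tail] each error is the preceding one divided by a tail. Division by [btail], at least
    [l y] in modulus, gains one power. Division by the next [tail] gains another if [u] is non-zero;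
    otherwise [w] is non-zero and keeps that tail away from 0. *)
Lemma err_decays n : decays (kappa_of n).+1 (errC n) /\ decays (kappa_of n.+1) (errA n).
Proof.
case: (cf) => _ u0 l0 uw _.
have stepC j d : decays d (fun z => if j is j'.+1 then errA j' z else -1) ->
    decays d.+1 (errC j).
  move=> [K [y0 [y01 H]]]; exists (K / l j.+1), y0; split=> // y yy0.
  have y_0 : 0 < y by rewrite (lt_le_trans _ yy0) // (lt_le_trans _ y01).
  have iy : 0 < complex.Im (0 +i* y) by [].
  have [/(_ (ltnSn j)) E _] := err_tail j.+1 j iy.
  rewrite ler_pdivlMr ?l0 //; apply: le_trans (H y yy0).
  move/(congr1 (fun c => modulus c)): E; rewrite normcN Normc.normcM => <-.
  have /andP[_ bn] := btail_norm (ltnSn j) iy.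
  have h : modulus (errC j (0 +i* y)) * (l j.+1 * y) * y ^+ d <=
      modulus (errC j (0 +i* y)) * modulus (btail j.+1 j (0 +i* y)) * y ^+ d.
    by rewrite ler_wpM2r ?exprn_ge0 ?(ltW y_0) // ler_wpM2l ?modulus_ge0.
  by apply: le_trans h; rewrite exprS le_eqVlt; apply/orP; left; apply/eqP; ring.
have stepA j d : decays d (errC j) -> decays (d + (u j.+1 != 0)) (errA j).
  move=> [K [y0 [y01 H]]].
  have E y : 0 < y -> modulus (errC j (0 +i* y)) =
      modulus (tail j.+2 j.+1 (0 +i* y)) * modulus (errA j (0 +i* y)).
    move=> y_0; have iy : 0 < complex.Im (0 +i* y) by [].
    have [_ /(_ (ltnSn _)) ->] := err_tail j.+2 j iy.
    by rewrite Normc.normcM normcN.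
  have [uj|uj] /= := eqVneq (u j.+1) 0; last first.
    have up : 0 < u j.+1 by rewrite lt_def uj u0.
    exists (K / u j.+1), y0; split=> // y yy0.
    have y_0 : 0 < y by rewrite (lt_le_trans _ yy0) // (lt_le_trans _ y01).
    have iy : 0 < complex.Im (0 +i* y) by [].
    rewrite ler_pdivlMr //; apply: le_trans (H y yy0); rewrite E //.
    have tn : u j.+1 * y <= modulus (tail j.+2 j.+1 (0 +i* y)).
      apply: le_trans (modulus_Im _); apply: le_trans (ler_norm _).
      by apply: ltW; exact: (tail_Im_lower (ltnSn _) iy).
    have h : modulus (errA j (0 +i* y)) * (u j.+1 * y) * y ^+ d <=
        modulus (errA j (0 +i* y)) * modulus (tail j.+2 j.+1 (0 +i* y)) * y ^+ d.
      by rewrite ler_wpM2r ?exprn_ge0 ?(ltW y_0) // ler_wpM2l ?modulus_ge0.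
    rewrite [modulus (tail _ _ _) * _]mulrC; apply: le_trans h.
    by rewrite addn1 exprS le_eqVlt; apply/orP; left; apply/eqP; ring.
  have wj : 0 < `|w j.+1| by have := uw j.+1 isT; rewrite uj add0r.
  (* Beyond the second threshold [1 / btail] is at most [|w| / 2] in modulus, so half of [|w|] is
     left. *)
  exists (K / (`|w j.+1| / 2)), (Num.max y0 (2 / (l j.+2 * `|w j.+1|))).
  split; first by rewrite le_max y01.
  move=> y; rewrite ge_max => /andP[yy0 yl].
  have y_0 : 0 < y by rewrite (lt_le_trans _ yy0) // (lt_le_trans _ y01).
  have iy : 0 < complex.Im (0 +i* y) by [].
  have lw : 0 < l j.+2 * `|w j.+1| by rewrite mulr_gt0 // l0.
  rewrite addn0 ler_pdivlMr ?divr_gt0 //; apply: le_trans (H y yy0); rewrite E //.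
  suff tn : `|w j.+1| / 2 <= modulus (tail j.+2 j.+1 (0 +i* y)).
    rewrite mulrC mulrA ler_wpM2r ?exprn_ge0 ?(ltW y_0) // ler_wpM2r ?modulus_ge0 //.
  rewrite tailS // uj mul0r add0r; apply: le_trans (modulus_lower _ _).
  rewrite modulus_real div1r Normc.normcV.
  have /andP[b0 bn] := btail_norm (ltnSn j.+1) iy; rewrite /= in b0 bn.
  have : (modulus (btail j.+2 j.+1 (0 +i* y)))^-1 <= `|w j.+1| / 2.
    have le1 : (modulus (btail j.+2 j.+1 (0 +i* y)))^-1 <= (l j.+2 * y)^-1.
      by rewrite lef_pV2 // posrE //; exact: lt_le_trans bn.
    apply: le_trans le1 _; rewrite -div1r ler_pdivrMr //.
    by move: yl; rewrite ler_pdivrMr // => yl; move: yl; lra.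
  by lra.
elim: n => [|n [IHC IHA]].
  have C0 : decays 1 (errC 0).
    apply: (stepC 0%N 0%N); exists 1, 1; split=> // y _.
    by rewrite mulr1 normcN Normc.normc1.
  by split=> //; exact: (stepA 0%N 1%N C0).
have CS := stepC n.+1 _ IHA; split=> //.
by have := stepA _ _ CS; rewrite addSn.
Qed.

End Convergents.

(** * From the expansion to moments *)

Section Tauberian.
Local Open Scope classical_set_scope.
Variables (R : realType) (rho : {measure set (measurableTypeR R) -> \bar R}).
Variable f : R -> R.
Hypothesis mf : measurable_fun setT f.
Hypothesis f0 : forall x, 0 <= f x.
Hypothesis fi : integrableR rho (fun x => f x / (1 + x ^+ 2)).

Let den (y x : R) := x ^+ 2 + y ^+ 2.

Let den_gt0 y x : 0 < y -> 0 < den y x.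
Proof. by move=> y0; rewrite ltr_wpDl ?sqr_ge0 // exprn_gt0. Qed.

Let measurable_den_inv y : 0 < y -> measurable_fun setT (fun x : R => (den y x)^-1).
Proof.
move=> y0; have z0 : nonreal (0 +i* y) by rewrite /nonreal /= gt_eqF.
have -> : (fun x : R => (den y x)^-1) = fun x => y^-1 * kernel_im (0 +i* y) x.
  by apply/funext => x; rewrite /kernel_im /kernel_den /den /= subr0 mulKf ?gt_eqF.
by apply: measurable_funM; [exact: measurable_cst|exact: measurable_kernel_im].
Qed.

Lemma integrableR_resolvent y : 1 <= y -> integrableR rho (fun x => f x / (x ^+ 2 + y
  ^+ 2)).
Proof.
move=> y1; have y0 : 0 < y by exact: lt_le_trans y1.
apply: integrableR_dom fi; first by apply: measurable_funM => //; exact: measurable_den_inv.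
move=> x; rewrite !ger0_norm ?divr_ge0 ?addr_ge0 ?sqr_ge0 //.
rewrite ler_wpM2l // lef_pV2 ?posrE ?den_gt0 //; last by rewrite ltr_pwDl ?sqr_ge0.
by rewrite addrC lerD2l expr_ge1 // ltW.
Qed.

Let seqy (n : nat) : R := n.+1%:R.

Let seqy_ge1 n : 1 <= seqy n. Proof. by rewrite /seqy ler1n. Qed.
Let seqy_gt0 n : 0 < seqy n. Proof. exact: lt_le_trans (seqy_ge1 n). Qed.

Let inv_den_cvg0 (c x : R) : 0 <= c -> (fun n => c / den (seqy n) x) @ \oo --> (0 : R).
Proof.
move=> c0; apply: (@squeeze_cvgr _ _ _ _ (fun=> 0) (fun n => c * @harmonic R n)).
- apply: nearW => n; rewrite divr_ge0 ?(ltW (den_gt0 _ _)) //=.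
  rewrite ler_wpM2l // lef_pV2 ?posrE ?den_gt0 // /den.
  have := seqy_ge1 n; rewrite -/(seqy n) expr2 => h.
  rewrite (@le_trans _ _ (seqy n * seqy n)) ?lerDr ?sqr_ge0 //.
  by rewrite ler_peMl // ltW.
- exact: cvg_cst.
- rewrite -[X in _ --> X](mulr0 c); apply: cvgM; first exact: cvg_cst.
  exact: cvg_harmonic.
Qed.

Let resolvent_cvg0 : (fun n => \int[rho]_x (f x / den (seqy n) x)) @ \oo --> (0 : R).
Proof.
have [] := @dominated_convergence _ _ R rho setT measurableT
  (fun n x => (f x / den (seqy n) x)%:E) (cst 0%E) (fun x => (f x / (1 + x ^+ 2))%:E).
- move=> n; apply/measurable_EFinP; apply: measurable_funM => //.
  exact: measurable_den_inv.
- exact: measurable_cst.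
- apply: aeW => x _; apply: cvg_EFin; first exact: nearW.
  exact: inv_den_cvg0.
- exact: fi.
- apply: aeW => x n _ /=; rewrite lee_fin ger0_norm ?divr_ge0 ?(ltW (den_gt0 _ _)) //.
  rewrite ler_wpM2l // lef_pV2 ?posrE ?den_gt0 //; last by rewrite ltr_pwDl ?sqr_ge0.
  by rewrite /den addrC lerD2l expr_ge1 // ltW.
move=> _ _; rewrite integral0 => /fine_cvg; exact.
Qed.

Let resolvent_small (e : R) : 0 < e ->
  exists N, forall n, (N <= n)%N -> \int[rho]_x (f x / den (seqy n) x) < e.
Proof.
move=> e0; have /cvgrPdist_lt/(_ e e0)[N _ H] := resolvent_cvg0.
exists N => n Nn; have := H n Nn; rewrite /= sub0r normrN ger0_norm //.
by apply: Rintegral_ge0 => x _; rewrite divr_ge0 // ltW // den_gt0.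
Qed.

(** As [y] grows, [y^2 f x / (x^2 + y^2)] increases to [f x], so monotone convergence applies along
    the integers. *)
Lemma integrableR_of_bounded_resolvent K (N : nat) :
  (forall n, (N <= n)%N ->
    n.+1%:R ^+ 2 * \int[rho]_x (f x / (x ^+ 2 + n.+1%:R ^+ 2)) <= K) ->
  integrableR rho f.
Proof.
move=> H; pose g n (x : R) := (seqy n ^+ 2 * (f x / den (seqy n) x))%:E.
have gi n : integrableR rho (fun x => seqy n ^+ 2 * (f x / den (seqy n) x)).
  by apply: integrableRZ; exact: integrableR_resolvent.
have cvg_g : (\int[rho]_x g n x @[n --> \oo] --> \int[rho]_x (f x)%:E)%E.
  have -> : (fun x => (f x)%:E) = fun x => limn (g^~ x).
    apply/funext => x; apply/esym/cvg_lim => //; apply: cvg_EFin; first exact: nearW.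
    have -> : fine \o g^~ x = fun n => f x - f x * (x ^+ 2 / den (seqy n) x).
      apply/funext => n /=; have := den_gt0 x (seqy_gt0 n); rewrite /den => d0.
      by move: (seqy n) d0 => s d0; field; rewrite gt_eqF.
    rewrite -[X in _ --> X]subr0; apply: cvgB; first exact: cvg_cst.
    rewrite -[X in _ --> X](mulr0 (f x)); apply: cvgM; first exact: cvg_cst.
    exact: inv_den_cvg0 (sqr_ge0 x).
  apply: cvg_monotone_convergence => //.
  - by move=> n; apply/measurable_EFinP; exact: (integrableR_measurable (gi n)).
  - move=> n x _; rewrite lee_fin mulr_ge0 ?sqr_ge0 // divr_ge0 // ltW // den_gt0 //.
  - move=> x _ i j ij; rewrite lee_fin.
    have sij : seqy i <= seqy j by rewrite /seqy ler_nat ltnS.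
    have di := den_gt0 x (seqy_gt0 i); have dj := den_gt0 x (seqy_gt0 j).
    rewrite mulrCA [leRHS]mulrCA ler_wpM2l // ler_pdivrMr // mulrAC ler_pdivlMr //.
    have sq : seqy i ^+ 2 <= seqy j ^+ 2.
      by rewrite ler_pXn2r ?nnegrE // ltW.
    rewrite /den !mulrDr lerD //; last by rewrite mulrC.
    by rewrite ler_wpM2r ?sqr_ge0.
apply/integrableP; split; first exact/measurable_EFinP.
have -> : (\int[rho]_x `|(EFin \o f) x| = \int[rho]_x (f x)%:E)%E.
  by apply: eq_integral => x _; rewrite /= ger0_norm.
apply: (@le_lt_trans _ _ K%:E); last exact: ltey.
apply: (cvge_to_le cvg_g); exists N => // n Nn /=.
rewrite /g -(fineK (integrable_fin_num measurableT (gi n))) lee_fin.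
have := H n Nn; rewrite -integralRZ //; exact: (integrableR_resolvent (seqy_ge1 n)).
Qed.

(** By dominated convergence the integral tends to 0, so the first term is [o(y^2)] and [T] has
    degree at most 1. On the imaginary axis the real part of such a [T] is constant, hence the first
    term is bounded. *)
Lemma tauberian (T : {poly R}) :
  decays 0 (fun z => (complex.Im z ^+ 2 *
     \int[rho]_x (f x / (x ^+ 2 + complex.Im z ^+ 2)))%:C - (toC T).[z]) ->
  integrableR rho f.
Proof.
move=> [K [y0 [y01 H]]].
pose F y := \int[rho]_x (f x / (x ^+ 2 + y ^+ 2)).
have {}H y : y0 <= y -> modulus ((y ^+ 2 * F y)%:C - (toC T).[0 +i* y]) <= K.
  by move=> yy0; have := H y yy0; rewrite mulr1.
have y0n : exists N0, forall n, (N0 <= n)%N -> y0 <= seqy n.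
  exists (Num.truncn y0) => n nN; apply: ltW; apply: lt_le_trans (truncnS_gt _) _.
  by rewrite /seqy ler_nat.
have [N0 HN0] := y0n.
have sT : (size T <= 2)%N.
  rewrite leqNgt; apply/negP => sT.
  have T0 : T != 0 by rewrite -size_poly_gt0 (ltn_trans _ sT).
  have [c [y1 [c0 y11 H1]]] := poly_lower T0.
  have [N HN] := resolvent_small (divr_gt0 c0 (ltr0Sn R 1)).
  (* At [y = n + 1] the modulus of [T] is at least [c y^2], while both [K] and [y^2 * F y] are below
     [c / 2 * y^2], a contradiction. *)
  pose K1 := `|K| * (2 / c).
  pose n := (N + N0 + Num.truncn y1 + Num.truncn K1)%N.
  have nN : (N <= n)%N by rewrite /n -!addnA leq_addr.
  have nN0 : (N0 <= n)%N by rewrite /n addnAC -!addnA addnCA leq_addr.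
  set y := seqy n.
  have yy1 : y1 <= y.
    apply: ltW; apply: lt_le_trans (truncnS_gt _) _; rewrite ler_nat ltnS.
    by rewrite /n addnAC leq_addl.
  have yK : K1 < y.
    apply: lt_le_trans (truncnS_gt _) _; rewrite ler_nat ltnS /n leq_addl //.
  have y_1 : 1 <= y by exact: seqy_ge1.
  have y_0 : 0 < y by exact: seqy_gt0.
  have e1 := H1 y yy1; have e2 := H y (HN0 n nN0); have e3 := HN n nN.
  have e4 : c * y ^+ 2 <= modulus (toC T).[0 +i* y].
    apply: le_trans e1; rewrite ler_wpM2l ?(ltW c0) // ler_weXn2l //.
    by rewrite -ltnS prednK // (ltn_trans _ sT).
  have F0 : 0 <= F y.
    by apply: Rintegral_ge0 => x _; rewrite divr_ge0 // ltW // den_gt0.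
  have e5 : modulus (toC T).[0 +i* y] - y ^+ 2 * F y <= K.
    apply: le_trans e2; have := modulus_lower (toC T).[0 +i* y] (- (y ^+ 2 * F y)%:C).
    rewrite normcN modulus_real ger0_norm; last by rewrite mulr_ge0 ?sqr_ge0.
    by rewrite -(normcN (_ + _)) opprD opprK [- _ + _]addrC.
  have e6 : y ^+ 2 * F y <= y ^+ 2 * (c / 2).
    by rewrite ler_wpM2l ?sqr_ge0 // ltW.
  have e7 : `|K| < y ^+ 2 * (c / 2).
    have c2 : 0 < c / 2 by rewrite divr_gt0.
    have : K1 * (c / 2) < y * (c / 2) by rewrite ltr_pM2r.
    have -> : K1 * (c / 2) = `|K| by rewrite /K1; field; rewrite gt_eqF.
    move=> h; apply: (lt_le_trans h); rewrite ler_wpM2r ?(ltW c2) //.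
    by rewrite expr2 ler_peMl // ltW.
  have := ler_norm K; move: e4 e5 e6 e7.
  set A := y ^+ 2; set B := A * F y; set D := modulus _; nra.
apply: (@integrableR_of_bounded_resolvent (K + `|T`_0|) N0) => n nN.
have e := H (seqy n) (HN0 n nN); set y := seqy n in e.
have : `|complex.Re ((y ^+ 2 * F y)%:C - (toC T).[0 +i* y])| <= K.
  exact: le_trans (modulus_Re _) e.
rewrite raddfB /=.
have -> : complex.Re (toC T).[0 +i* y] = T`_0.
  rewrite (horner_coef_wide _ (n := 2)) ?(leq_trans (size_poly _ _)) //.
  by rewrite big_ord_recl big_ord1 /= !coef_map /=; simpc; ring.
rewrite ler_norml => /andP[_ h]; move: h; rewrite lerBlDr => h.
by apply: (le_trans h); rewrite lerD2l ler_norm.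
Qed.

End Tauberian.

(** * Polynomial asymptotics along the imaginary axis *)

Section Asymptotics.
Variable R : realType.
Implicit Types (f : R[i] -> R[i]) (p q T : {poly R}).

Lemma decays_div f q : q != 0 -> decays 0 f -> decays 0 (fun z => f z / (toC q).[z]).
Proof.
move=> /poly_lower[c [y1 [c0 y11 H1]]] [K [y0 [y01 H]]].
exists (K / c), (Num.max y0 y1); split; first by rewrite le_max y01.
move=> y; rewrite ge_max => /andP[yy0 yy1]; rewrite mulr1.
have cq : c <= modulus (toC q).[0 +i* y].
  apply: le_trans (H1 y yy1); rewrite ler_peMr ?(ltW c0) // exprn_ege1 //.
  exact: le_trans yy1.
have q0 : 0 < modulus (toC q).[0 +i* y] by exact: lt_le_trans cq.
have := H y yy0; rewrite mulr1 => hf.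
rewrite Normc.normcM Normc.normcV ler_pM ?modulus_ge0 ?invr_ge0 ?modulus_ge0 //.
by rewrite lef_pV2 ?posrE.
Qed.

Lemma decays_ratio p q : q != 0 -> (size p <= size q)%N ->
  decays 0 (fun z => (toC p).[z] / (toC q).[z]).
Proof.
move=> q0 spq; have [c [y1 [c0 y11 H1]]] := poly_lower q0.
have [K K0 H] := poly_upper p.
exists (K / c), y1; split=> // y yy1; have y_1 := le_trans y11 yy1.
have y_0 : 0 < y by exact: lt_le_trans y_1.
have qn := H1 y yy1; have pn := H y y_1.
have yd : 0 < y ^+ (size q).-1 by rewrite exprn_gt0.
have q_0 : 0 < modulus (toC q).[0 +i* y] by apply: lt_le_trans qn; rewrite mulr_gt0.
rewrite mulr1 Normc.normcM Normc.normcV ler_pdivrMr // mulrAC ler_pdivlMr //.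
apply: (@le_trans _ _ (K * y ^+ (size q).-1 * c)); last first.
  by rewrite -mulrA ler_wpM2l // mulrC.
rewrite ler_wpM2r ?(ltW c0) //; apply: (le_trans pn); rewrite ler_wpM2l //.
by rewrite ler_weXn2l // -!subn1 leq_sub2r.
Qed.

(** [E] is the even part of [T]. Multiplication by ['X] exchanges even and odd parts, hence the
    joint induction with [D]. *)
Lemma even_part T : exists E : {poly R}, forall y,
  (toC E).[0 +i* y] = (complex.Re (toC T).[0 +i* y])%:C.
Proof.
suff [E [D H]] : exists E D : {poly R}, forall y,
    (toC E).[0 +i* y] = (complex.Re (toC T).[0 +i* y])%:C /\
    (toC D).[0 +i* y] = 0 +i* (complex.Im (toC T).[0 +i* y]).
  by exists E => y; case: (H y).
elim/poly_ind: T => [|p t [E [D H]]].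
  by exists 0, 0 => y; rewrite rmorph0 horner0.
exists ('X * D + t%:P), ('X * E) => y; have [hE hO] := H y.
rewrite !(evalD, evalM, evalX, evalC) hE hO; case: (toC p).[_] => a b; simpc.
by split; rewrite /= [y * _]mulrC.
Qed.

(** For the convergent [P / q] of index [M] the error [q m - P] is [O(y^-M)], so [z^M m] differs
    from [z^M P / q] by a bounded term. [T] is the quotient in the division of ['X^M * P] by [q],
    and the remainder over [q] is bounded. *)
Lemma cfrac_asymptotics (m : R[i] -> R[i]) mt u w l M : cfrac_expansion m mt u w l ->
  exists T : {poly R}, decays 0 (fun z => z ^+ M * m z - (toC T).[z]).
Proof.
move=> cf; pose n := M; have [P [Q PQ]] := errs_affine m u w l n.
set q := denC u w l n in PQ.
have q0 : q != 0.
  suff : q`_0 = 1 by apply: contra_eq_neq => ->; rewrite coef0 eq_sym oner_eq0.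
  rewrite /q; elim: (n) => [|j IH]; first by rewrite /denC /= coef1.
  by rewrite /denC /= -/(denC u w l j) coefD IH mulrCA coefXM add0r.
have kn : (n <= kappa_of u n)%N.
  by elim: (n) => // j IH /=; rewrite ltnS (leq_trans IH) // leq_addr.
exists (('X^M * P) %/ q).
have [dC _] := err_decays cf n.
have zdC d : (d <= (kappa_of u n).+1)%N -> decays 0 (fun z => z ^+ d * errC m u w l n z).
  elim: d => [|d IH] dk; first by apply: decays_eq (decays_leq _ dC) => // y _; rewrite
    expr0 mul1r.
  have : forall j, (j <= d.+1)%N -> decays (d.+1 - j) (fun z => z ^+ j * errC m u w l n z).
    elim=> [|j IHj] jd.
      rewrite subn0; apply: decays_eq (decays_leq dk dC) => y _.
      by rewrite expr0 mul1r.
    have := IHj (ltnW jd); rewrite subSn // => /decaysMX.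
    by apply: decays_eq => y _; rewrite exprS mulrA.
  by move=> /(_ d.+1 (leqnn _)); rewrite subnn.
have h1 := decays_div q0 (zdC M (leq_trans kn (leqnSn _))).
have h2 : decays 0 (fun z => (toC (('X^M * P) %% q)).[z] / (toC q).[z]).
  by apply: decays_ratio => //; rewrite ltnW // ltn_modp.
have [K [y0 [y01 H]]] := decaysD h1 h2.
have [c [y1 [c0 y11 Hq]]] := poly_lower q0.
exists K, (Num.max y0 y1); split; first by rewrite le_max y01.
move=> y; rewrite ge_max => /andP[yy0 yy1].
have qn : (toC q).[0 +i* y] != 0.
  rewrite -modulus_gt0; apply: lt_le_trans (Hq y yy1).
  by rewrite mulr_gt0 // exprn_gt0 // (lt_le_trans _ yy1) // (lt_le_trans _ y11).
apply: le_trans (H y yy0); rewrite le_eqVlt; apply/orP; left; apply/eqP.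
congr (modulus _ * _); set z := 0 +i* y.
have [-> _] := PQ z; have := congr1 (fun p => (toC p).[z]) (divp_eq ('X^M * P) q).
have evXn : (toC ('X^M : {poly R})).[z] = z ^+ M by rewrite map_polyXn hornerXn.
rewrite !(evalD, evalM) evXn => e.
set D := (toC (_ %/ _)).[z] in e *; set r := (toC (_ %% _)).[z] in e *.
have -> : z ^+ M * ((toC q).[z] * m z - (toC P).[z]) =
  z ^+ M * (toC q).[z] * m z - (D * (toC q).[z] + r) by rewrite -e; ring.
by field.
Qed.

End Asymptotics.

(** * Existence of the moments by induction *)

Section MomentsExist.
Variables (R : realType) (m : R[i] -> R[i]) (a b : R).
Variable rho : {measure set (measurableTypeR R) -> \bar R}.
Hypothesis m_repr : integral_representation a b rho m.
Variables (mt : nat -> R[i] -> R[i]) (u w l : nat -> R).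
Hypothesis cf : cfrac_expansion m mt u w l.
Implicit Types (f : R -> R) (y : R).

(* Only the real part of [G] matters: it is even in [y], so that the polynomial
   [T] may be replaced by its even part. *)
Lemma tauberian_Re f (G : R[i] -> R[i]) (T : {poly R}) :
  measurable_fun setT f -> (forall x, 0 <= f x) ->
  integrableR rho (fun x => f x / (1 + x ^+ 2)) ->
  decays 0 (fun z => G z - (toC T).[z]) ->
  (forall y, 1 <= y -> complex.Re (G (0 +i* y)) =
     - (y ^+ 2 * \int[rho]_x (f x / (x ^+ 2 + y ^+ 2)))) ->
  integrableR rho f.
Proof.
move=> mf f0 fi [K [y0 [y01 H]]] GE; have [E HE] := even_part T.
apply: (tauberian mf f0 fi (T := - E)); exists K, y0; split=> // y yy0.
have := H y yy0; rewrite !mulr1 => h; apply: le_trans h.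
rewrite rmorphN hornerN opprK HE -rmorphD modulus_real /=.
rewrite -[_ * _]opprK -GE ?(le_trans y01) //.
by apply: le_trans (modulus_Re _); rewrite raddfB /= -normrN opprD opprK.
Qed.

(** The case [f = 1]: by [repr_Im] the real part of [z m - b z^2] at [i y] is [- y^2] times the
    integral of [1 / (x^2 + y^2)]. *)
Let integrableR_even_pow0 : integrableR rho (fun=> 1).
Proof.
have fin : integrableR rho (fun x => 1 / (1 + x ^+ 2)).
  have [_ h _] := m_repr; have mz : nonreal (0 +i* 1 : R[i]).
    by rewrite /nonreal /= oner_eq0.
  have E (x : R) : 1 / (1 + x ^+ 2) = kernel_im (0 +i* 1) x.
    by rewrite /kernel_im /kernel_den /= subr0 expr1n addrC.
  apply/integrableP; split.
    apply/measurable_EFinP; have -> : (fun x : R => 1 / (1 + x ^+ 2)) = kernel_im (0 +i* 1).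
      by apply/funext.
    exact: measurable_kernel_im.
  have -> : (\int[rho]_x `|(EFin \o (fun x => 1 / (1 + x ^+ 2))%R) x| =
      \int[rho]_x ((1 + x ^+ 2)^-1)%:E)%E.
    apply: eq_integral => x _ /=.
    by rewrite div1r ger0_norm // invr_ge0 addr_ge0 ?sqr_ge0.
  exact: h.
have [T [K [y0 [y01 H]]]] := cfrac_asymptotics 1 cf.
apply: (@tauberian_Re (fun=> 1) (fun z => z * m z - b%:C * z ^+ 2) (T - b *: 'X^2)) => //.
  exists K, y0; split=> // y yy0; apply: le_trans (H y yy0).
  have e2 z : (toC ('X^2 : {poly R})).[z] = z ^+ 2 by rewrite map_polyXn hornerXn.
  rewrite rmorphB hornerD hornerN evalZ e2 expr1; set A := _ * m _; set B := b%:C * _.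
  set D := (toC T).[_]; have -> : A - B - (D - B) = A - D by ring.
  exact: lexx.
move=> y y1; have y_0 : 0 < y by exact: lt_le_trans y1.
have z0 : nonreal (0 +i* y) by rewrite /nonreal /= gt_eqF.
have im := repr_Im m_repr z0.
have -> : \int[rho]_x (1 / (x ^+ 2 + y ^+ 2)) = y^-1 * \int[rho]_x kernel_im (0 +i* y) x.
  have E : \int[rho]_x kernel_im (0 +i* y) x = \int[rho]_x (y * (1 / (x ^+ 2 + y ^+ 2))).
    by apply: eq_Rintegral => x _; rewrite /kernel_im /kernel_den /= subr0 div1r.
  rewrite E integralRZ ?mulKf ?gt_eqF //.
  exact: (integrableR_resolvent (f := fun=> 1)).
move: im; rewrite /=; case: (m _) => c d /= ->; simpc.
by rewrite /=; field; rewrite gt_eqF.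
Qed.

(** Moments up to order [2k] give [z^(2k+1) m] as the transform of ['X^(2k+1)] plus a polynomial.
    The real part of [z^2] times this transform at [i y] is [- y^2] times the integral of
    [x^(2k+2) / (x^2 + y^2)], so [tauberian_Re] applies to the asymptotics of [z^(2k+3) m]. *)
Let integrableR_even_pow k : integrableR rho (fun x => x ^+ k.*2).
Proof.
elim: k => [|k IH]; first exact: integrableR_even_pow0.
have low j : (j <= k.*2)%N -> integrableR rho (fun x => x ^+ j).
  move=> jk; apply: (integrableR_dom _ _ (integrableRD integrableR_even_pow0 IH)).
    by apply: measurable_funX; exact: measurable_id.
  move=> x; have h0 : 0 <= x ^+ k.*2 by rewrite exprn_even_ge0 // odd_double.
  rewrite [leRHS]ger0_norm ?addr_ge0 // normrX.
  have -> : x ^+ k.*2 = `|x| ^+ k.*2 by rewrite -normrX ger0_norm.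
  have [x1|/ltW x1] := leP `|x| 1.
    by rewrite (@le_trans _ _ 1) ?exprn_ile1 // lerDl exprn_ge0.
  by rewrite (le_trans (ler_weXn2l x1 jk)) // lerDr.
have ih j : (j <= k.*2)%N -> integrableR rho (horner 'X^j).
  move=> jk; apply: integrableR_horner => i; rewrite size_polyXn ltnS => ij.
  by apply: low; apply: leq_trans jk.
have i1 : integrableR rho (horner 1) by have := ih 0%N isT; rewrite expr0.
have [T2 HT2] : exists T2 : {poly R}, forall z, nonreal z ->
    z ^+ k.*2.+1 * m z = stieltjes rho 'X^(k.*2.+1) z + (toC T2).[z].
  have : forall j, (j <= k.*2.+1)%N -> exists T2 : {poly R}, forall z, nonreal z ->
      z ^+ j * m z = stieltjes rho 'X^j z + (toC T2).[z].
    elim=> [|j IHj] jk.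
      exists (b%:P * 'X + (- moment a b rho (- 1))%:P) => z z0.
      by rewrite !expr0 mul1r (repr_stieltjes m_repr i1 z0) !(evalD, evalM, evalX,
        evalC) addrC.
    have [T HT] := IHj (ltnW jk).
    exists ('X * T - (\int[rho]_x ('X^j).[x])%:P) => z z0.
    rewrite exprS -mulrA HT // exprS stieltjesMX //; last exact: ih.
    by rewrite rmorphB hornerD hornerN !(evalM, evalX, evalC); ring.
  by move=> /(_ _ (leqnn _)).
have [T [K [y0 [y01 H]]]] := cfrac_asymptotics k.*2.+3 cf.
have fE (x : R) : x ^+ k.+1.*2 = x ^+ k.*2.+1 * x by rewrite doubleS [LHS]exprSr.
apply: (@tauberian_Re _ (fun z => z ^+ 2 * stieltjes rho 'X^(k.*2.+1) z) (T - 'X^2 * T2)).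
- by apply: measurable_funX; exact: measurable_id.
- by move=> x; rewrite exprn_even_ge0 // odd_double.
- have z1 : nonreal (0 +i* 1 : R[i]) by rewrite /nonreal /= oner_eq0.
  apply: (integrableR_dom _ _ IH).
    apply: measurable_funM; first by apply: measurable_funX; exact: measurable_id.
    have -> : (fun x : R => (1 + x ^+ 2)^-1) = kernel_im (0 +i* 1).
      by apply/funext => x; rewrite /kernel_im /kernel_den /= subr0 expr1n addrC div1r.
    exact: measurable_kernel_im.
  move=> x; have d0 : 0 < 1 + x ^+ 2 by rewrite ltr_pwDl ?sqr_ge0.
  rewrite normrM normfV (gtr0_norm d0) ler_pdivrMr // doubleS -[k.*2.+2]addn2 exprD normrM.
  by rewrite ler_wpM2l // ger0_norm ?sqr_ge0 // lerDr.
- exists K, y0; split=> // y yy0; apply: le_trans (H y yy0).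
  have y_0 : 0 < y by rewrite (lt_le_trans _ yy0) // (lt_le_trans _ y01).
  have z0 : nonreal (0 +i* y) by rewrite /nonreal /= gt_eqF.
  have e2 z : (toC ('X^2 : {poly R})).[z] = z ^+ 2 by rewrite map_polyXn hornerXn.
  rewrite rmorphB hornerD hornerN evalM e2; set z := 0 +i* y in z0 *.
  have -> : z ^+ k.*2.+3 = z ^+ 2 * z ^+ k.*2.+1 by rewrite -exprD.
  rewrite -mulrA HT2 //; set A := stieltjes _ _ _; set B := (toC T2).[z].
  set D := (toC T).[z]; have -> : z ^+ 2 * A - (D - z ^+ 2 * B) = z ^+ 2 * (A + B) - D
    by ring.
  exact: lexx.
move=> y y1; have y_0 : 0 < y by exact: lt_le_trans y1.
rewrite expr2 /stieltjes; simpc; rewrite /= -expr2; congr (- (_ * _)).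
apply: eq_Rintegral => x _; rewrite hornerXn /kernel_re /kernel_den /= subr0 fE.
by rewrite mulrA.
Qed.

Lemma cfrac_moments : all_moments_exist rho.
Proof.
move=> k; have i2 : integrableR rho (fun x => `|x| ^+ k).
  apply: (integrableR_dom _ _ (integrableRD integrableR_even_pow0 (integrableR_even_pow
    k))).
    by apply: measurable_funX; apply: continuous_measurable_fun; exact: norm_continuous.
  move=> x; have h0 : 0 <= x ^+ k.*2 by rewrite exprn_even_ge0 // odd_double.
  rewrite [leRHS]ger0_norm ?addr_ge0 // normrX normr_id.
  have -> : x ^+ k.*2 = (`|x| ^+ k) ^+ 2.
    by rewrite -exprM muln2 -normrX ger0_norm.
  by have := sqr_ge0 (`|x| ^+ k - 1); nra.
have := integrable_lty measurableT i2; exact.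
Qed.

End MomentsExist.

(** * Identification of the constants *)

Section Uniqueness.
Variables (R : realType) (m : R[i] -> R[i]) (a b : R).
Variable rho : {measure set (measurableTypeR R) -> \bar R}.
Hypothesis m_repr : integral_representation a b rho m.
Hypothesis am : all_moments_exist rho.
Variable L : {scalar {poly R}}.
Hypothesis LE : forall p, L p = \int[rho]_x p.[x].
Variables (mt : nat -> R[i] -> R[i]) (u w l : nat -> R).
Hypothesis cf : cfrac_expansion m mt u w l.

Let s1 := moment a b rho (- 1).
Local Notation S := (stieltjes rho).
Local Notation C := (denC u w l).
Local Notation Rr := (denR u w l).
Local Notation EC := (errC m u w l).
Local Notation EA := (errA m u w l).

Lemma decays_stieltjes (p : {poly R}) : decays 1 (S p).
Proof.
pose I := \int[rho]_x `|p.[x]|; exists (I + I), 1; split=> // y y1.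
have y0 : 0 < y by exact: lt_le_trans y1.
have [h1 h2] := stieltjes_bound y0 (integrableR_poly am p).
rewrite expr1 -ler_pdivlMr // mulrDl.
apply: le_trans (modulus_le _) _; rewrite -/I in h1 h2.
by rewrite lerD // mulrC.
Qed.

(** The constant [L (p * 'X^j)] is the difference of [S (p * 'X^(j.+1))] and [z] times
    [S (p * 'X^j)]. For [j < d] both decay, so it is zero, and the decay passes on to [j.+1] with
    one power less. *)
Lemma decays_orth d (p : {poly R}) : decays d.+1 (S p) -> orth L d p.
Proof.
move=> dp.
have H j : (j <= d)%N -> decays (d.+1 - j) (S (p * 'X^j)) /\ orth L j p.
  elim: j => [|j IH] jd; first by rewrite subn0 expr0 mulr1; split.
  have [dj oj] := IH (ltnW jd).
  have E y : 0 < y -> S (p * 'X^(j.+1)) (0 +i* y) =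
      (0 +i* y) * S (p * 'X^j) (0 +i* y) + (L (p * 'X^j))%:C.
    move=> y0; have z0 : nonreal (0 +i* y) by rewrite /nonreal /= gt_eqF.
    by rewrite exprS mulrCA (moments_stieltjesMX am LE).
  have dz : decays (d.+1 - j.+1) (fun z => z * S (p * 'X^j) z).
    by apply: decaysMX; rewrite subnSK // ltnS ltnW.
  have L0 : L (p * 'X^j) = 0.
    have : decays 1 (horner (toC (L (p * 'X^j))%:P)).
      have dz1 : decays 1 (fun z => z * S (p * 'X^j) z).
        by apply: decays_leq dz; rewrite subSS subn_gt0.
      apply: decays_eq (decaysD (decays_stieltjes (p * 'X^(j.+1))) (decaysN dz1)) => y y0.
      by rewrite evalC E //; ring.
    by move/decays_poly_eq0/eqP; rewrite polyC_eq0 => /eqP.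
  split; first by apply: decays_eq dz => y y0; rewrite E // L0 addr0.
  by move=> i; rewrite ltnS leq_eqVlt => /predU1P[-> //|]; exact: oj.
by case: (H d (leqnn d)).
Qed.

(** Both sides are [p m] plus a polynomial, so they differ by a polynomial [W] that decays along the
    imaginary axis and must be zero. *)
Lemma err_stieltjes (f : R[i] -> R[i]) (p P : {poly R}) :
  (forall z, f z = (toC p).[z] * m z - (toC P).[z]) -> decays 1 f ->
  forall z, nonreal z -> f z = S p z.
Proof.
move=> fE df; have [T TE] := stieltjes_affine am LE p.
pose W := p * (b%:P * 'X - s1%:P) - P - T.
have E z : nonreal z -> f z = S p z + (toC W).[z].
  move=> z0; rewrite fE TE // (repr_stieltjes m_repr (integrableR_poly am 1) z0) -/s1.
  by rewrite !(evalD, evalN, evalM, evalX, evalC) rmorphN; ring.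
have W0 : W = 0.
  apply: decays_poly_eq0; apply: decays_eq (decaysD df (decaysN (decays_stieltjes p)))
    => y y0.
  have z0 : nonreal (0 +i* y) by rewrite /nonreal /= gt_eqF.
  by rewrite E //; ring.
by move=> z z0; rewrite E // W0 rmorph0 horner0 addr0.
Qed.

Lemma errC_stieltjes n z : nonreal z -> EC n z = S (C n) z.
Proof.
have [P [Q PQ]] := errs_affine m u w l n.
apply: (err_stieltjes (P := P)) => [z'|]; first by case: (PQ z').
by apply: decays_leq (err_decays cf n).1.
Qed.

Lemma errA_stieltjes n z : nonreal z -> EA n z = S ('X * Rr n) z.
Proof.
have [P [Q PQ]] := errs_affine m u w l n.
apply: (err_stieltjes (P := Q)) => [z'|]; first by case: (PQ z').
by apply: decays_leq (err_decays cf n).2.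
Qed.

Lemma cfrac_chain : chain L C Rr u w l (kappa_of u).
Proof.
have orthC n : orth L (kappa_of u n) (C n).
  apply: decays_orth; apply: decays_eq (err_decays cf n).1 => y y0.
  by apply: errC_stieltjes; rewrite /nonreal /= gt_eqF.
have orthA n : orth L (kappa_of u n.+1).-1 ('X * Rr n).
  apply: decays_orth; apply: decays_eq (err_decays cf n).2 => y y0.
  by apply: errA_stieltjes; rewrite /nonreal /= gt_eqF.
case: (cf) => _ u0 l0 uw _; split=> //.
- by move=> n; exact: l0.
- move=> n; have := uw n.+1 isT; apply: contraTT.
  by rewrite negb_or !negbK => /andP[/eqP-> /eqP->]; rewrite normr0 addr0 ltxx.
(* For [n = 0], [errA0] and the transform of ['X * Rr 0] are compared at the imaginary unit, which
   leaves [L (Rr 0) = -1]. Each later step adds a multiple of [C n.+1], which is orthogonal to 1. *)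
- elim=> [|n IH].
    have z0 : nonreal (0 +i* 1 : R[i]) by rewrite /nonreal /= oner_eq0.
    have := errA0 m u w l (0 +i* 1); rewrite errA_stieltjes // errC_stieltjes //.
    have -> : 'X * Rr 0 = - l 1%N *: ('X * 1) by rewrite /denR /= -mul_polyC mulr1 mulrC.
    rewrite (moments_stieltjesZ am) // (moments_stieltjesMX am LE) // /denC /= mulrDr
      mulrA rmorphN => /addrI.
    rewrite /denR /= -[(_)%:P]mulr1 mul_polyC linearZ /= -rmorphN -rmorphM => /(congr1
      (@complex.Re R)).
    by [].
  have -> : Rr n.+1 = - l n.+2 *: C n.+1 + Rr n by [].
  by rewrite linearD linearZ /= IH (orth1 _ (orthC n.+1)) // mulr0 add0r.
Qed.

(** As [errC 0] is the transform of 1, comparison with the representation at the imaginary unit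
    gives [u 0] and [w 0] as imaginary and real parts. *)
Lemma cfrac_uw0 : u 0%N = b /\ w 0%N = - s1.
Proof.
have z0 : nonreal (0 +i* 1 : R[i]) by rewrite /nonreal /= oner_eq0.
have := errC_stieltjes 0 z0; rewrite /errC /denC /=.
have := repr_stieltjes m_repr (integrableR_poly am 1) z0; rewrite -/s1.
set s := S 1 _ => ->; move: s => [s s']; simpc => -[e1 e2].
by split; move: e1 e2; lra.
Qed.

End Uniqueness.

(** * Identification of the enumeration and of the determinants *)

Lemma enumerates_unique (R : realType) (d : nat -> R) (k1 k2 : nat -> nat) :
  enumerates_nonzero d k1 -> enumerates_nonzero d k2 ->
  forall n, (1 <= n)%N -> k1 n = k2 n.
Proof.
(* If both agree below [n], then [k'] attains the value [k n] at an index not below [n]. *)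
have half (k k' : nat -> nat) n : enumerates_nonzero d k -> enumerates_nonzero d k' ->
    (1 <= n)%N -> (forall j, (1 <= j)%N -> (j < n)%N -> k j = k' j) -> (k' n <= k n)%N.
  move=> [inc nz] [inc' nz'] n1 IH.
  have /nz'[n' n'1 e] : d (k n) != 0 by apply/nz; exists n.
  rewrite -e; have [lt|le] := ltnP n' n.
    by have := inc n' n n'1 lt; rewrite IH // e ltnn.
  by move: le; rewrite leq_eqVlt => /predU1P[<- //|/(inc' _ _ n1)/ltnW].
move=> e1 e2; elim/ltn_ind => n IH n1; apply/eqP; rewrite eqn_leq.
by rewrite (half _ _ n e1 e2) ?(half _ _ n e2 e1) // => j j1 jn; rewrite IH.
Qed.

Section HankelMoments.
Variables (R : realType) (a b : R).
Variable rho : {measure set (measurableTypeR R) -> \bar R}.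

Definition shifted_moment (i : nat) : R := moment a b rho (- 2 + i%:Z).

Lemma hankel_detE (j : nat) n :
  hankel_det a b rho (- 2 + j%:Z) n = hankel (fun i => shifted_moment (j + i)%N) n.
Proof.
congr (\det _); apply/matrixP => p q; rewrite !mxE /shifted_moment.
by congr (moment a b rho _); rewrite !PoszD !addrA.
Qed.

Variable L : {scalar {poly R}}.
Hypothesis LE : forall p, L p = \int[rho]_x p.[x].

Lemma functional_Xn i : L 'X^i = shifted_moment i.+2.
Proof.
rewrite LE /shifted_moment; have -> : (- 2 + i.+2%:Z)%R = i%:Z by lia.
by apply: eq_Rintegral => x _; rewrite hornerXn.
Qed.

(** Every index is some [k n], where the determinant is non-zero, or lies strictly between
    successive values, where it vanishes. *)
Lemma chain_enumerates C Rr u w l k : positive_definite L ->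
  chain L C Rr u w l k ->
  enumerates_nonzero (hankel_det a b rho 1) (fun n => k n.-1).
Proof.
move=> pd ch; have D1E n : hankel_det a b rho 1 n = hankel (fun i => shifted_moment i.+3) n.
  exact: (hankel_detE 3 n).
have inc i j : (i < j)%N -> (k i < k j)%N.
  by apply: (homo_ltn ltn_trans (f := k)) => n; exact: chain_k_lt ch n.
split.
  by case=> // n [|n'] //= _; rewrite ltnS; exact: inc.
move=> j; split=> [nz|[n _ <-]]; last by rewrite D1E (hankel1_chain_neq0 functional_Xn
  pd ch).
have [n kn] : exists n, (k n <= j < k n.+1)%N.
  have ex : exists n, (j < k n)%N.
    exists j.+1; elim: (j) => [|i IH]; first by rewrite (chain_k_gt0 ch).
    by apply: leq_ltn_trans IH (inc _ _ _).
  have /ex_minnP[n jn min] := ex; case: n jn min => [|n] jn min.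
    by move: jn; rewrite (chain_k0 ch).
  exists n; rewrite jn andbT leqNgt; apply/negP => /min.
  by rewrite ltnn.
exists n.+1 => //=; move: kn; rewrite leq_eqVlt => /andP[/predU1P[//|lt1] lt2].
by move: nz; rewrite D1E (hankel1_gap functional_Xn ch (n := n)) ?eqxx // lt1.
Qed.

End HankelMoments.

Unset Implicit Arguments.

Theorem corollary1p8 (R : realType) (m : R[i] -> R[i]) (a b : R)
    (rho : {measure set (measurableTypeR R) -> \bar R})
    (m_herglotz : herglotz m) (m_nonrational : ~ rational_function m)
    (m_repr : integral_representation a b rho m) :
  let D := hankel_det a b rho in
  (all_moments_exist rho <->
    exists (mt : nat -> R[i] -> R[i]) (u w l : nat -> R),
      cfrac_expansion m mt u w l)
  /\
  (all_moments_exist rho ->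
    exists2 kappa : nat -> nat, enumerates_nonzero (D 1) kappa &
    forall (mt : nat -> R[i] -> R[i]) (u w l : nat -> R),
      cfrac_expansion m mt u w l ->
      [/\ u 0%N = - (D (- 2) 1%N / D 0 0%N),
          w 0%N = - (D (- 1) 1%N / D 1 0%N)
        & forall n : nat, (1 <= n)%N ->
          [/\ u n = D (- 2) (kappa n + 2)%N / D 0 (kappa n + 1)%N
                    - D (- 2) (kappa n.+1 + 1)%N / D 0 (kappa n.+1),
              w n = D (- 1) (kappa n + 1)%N / D 1 (kappa n)
                    - D (- 1) (kappa n.+1 + 1)%N / D 1 (kappa n.+1)
            & l n = D 1 (kappa n) ^+ 2
                    / (D 0 (kappa n) * D 0 (kappa n + 1)%N)]]).
Proof.
move=> D; split.
  split=> [am|[mt [u [w [l cf]]]]]; last exact: (cfrac_moments m_repr cf).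
  exact: (cfrac_exists m_herglotz m_nonrational m_repr am).
move=> am; have [L LE] := moment_functional am.
have pd : positive_definite L.
  exact: (moment_posdef am LE (infinite_support m_nonrational m_repr am)).
have [mt0 [u0 [w0 [l0 cf0]]]] := cfrac_exists m_herglotz m_nonrational m_repr am.
have e0 := chain_enumerates a b LE pd (cfrac_chain m_repr am LE cf0).
(* [kappa] is built from one expansion; the degrees for any other one enumerate the same set of
   indices and so agree with it. *)
pose kappa n := kappa_of u0 n.-1; exists kappa => // mt u w l cf.
have ch := cfrac_chain m_repr am LE cf.
have e := chain_enumerates a b LE pd ch.
have kE n : kappa n.+1 = kappa_of u n by exact: (enumerates_unique e0 e (n := n.+1)).
have LX := functional_Xn a b LE.
have [uE wE] := cfrac_uw0 m_repr am LE cf.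
have det0 j : D j 0%N = 1 by rewrite /D /hankel_det det_mx00.
have det1 j : D j 1%N = moment a b rho j.
  by rewrite /D /hankel_det det_mx11 mxE !addr0.
split; rewrite ?det0 ?det1 ?divr1 //; first by rewrite uE /= opprK.
case=> // n _; rewrite !kE /D.
have Dm2 k : hankel_det a b rho (- 2) k = hankel (shifted_moment a b rho) k.
  exact: (hankel_detE a b rho 0 k).
have Dm1 k : hankel_det a b rho (- 1) k = hankel (fun i => shifted_moment a b rho i.+1) k.
  exact: (hankel_detE a b rho 1 k).
have D0 k : hankel_det a b rho 0 k = hankel (fun i => shifted_moment a b rho i.+2) k.
  exact: (hankel_detE a b rho 2 k).
have D1 k : hankel_det a b rho 1 k = hankel (fun i => shifted_moment a b rho i.+3) k.
  exact: (hankel_detE a b rho 3 k).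
by rewrite !Dm2 !Dm1 !D0 !D1; split;
  [exact: (chain_uE LX pd ch)|exact: (chain_wE LX pd ch)|exact: (chain_lE LX pd ch)].
Qed.
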